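(* Let $\mathcal C$ be a small site, $\mathcal H$ a gerbe on $\mathcal C$ and $\Theta$ a type for $\mathcal H$. There exists a gerbe $\mathcal N$ on $\mathcal C$ with a morphism $\nu:\mathcal N\to\mathcal H$, called the normalizer of $\Theta$, with the following properties. (1) $\nu$ is faithful. (2) For every functor $\psi:X\to\mathrm P_{\mathcal H}$ of type $\Theta$, with composition $f:X\to\mathrm P_{\mathcal H}\to\mathcal H$, there exists a factorization $X\xrightarrow{\mu}\mathcal N\xrightarrow{\nu}\mathcal H$ of $f$ with the following property: for every $S\in\mathcal C$ and $x,y\in X(S)$, the sheaf $\underline{\mathrm{Isom}}_{\mathcal N}(\mu(x),\mu(y))$ is the subsheaf of isomorphisms $\alpha\in\underline{\mathrm{Isom}}_{\mathcal H}(f(x),f(y))$ such that $\alpha^{-1}\psi(y)\alpha=\psi(x)\subseteq\underline{\mathrm{Aut}}_{\mathcal H}(f(x))$. In particular, $\underline{\mathrm{Aut}}_{\mathcal N}(\mu(x))$ is the normalizer of $\psi(x)$ in $\underline{\mathrm{Aut}}_{\mathcal H}(f(x))$. (3) The normalizer is unique in the following sense: if $\mathcal N'$ is a gerbe with a faithful morphism $\mathcal N'\to\mathcal H$ and $\mathcal S\to\mathrm P_{\mathcal H}$ is a pre-type in $\Theta$ with a factorization $\mathcal S\to\mathcal N'\to\mathcal H$ having the property described in (2), there exists an isomorphism $\mathcal N\to\mathcal N'$ making the diagram formed by $\mathcal S\to\mathcal N\to\mathcal H$, $\mathcal S\to\mathcal N'\to\mathcal H$ and $\mathcal N\to\mathcal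 N'$ $2$-commutative.
   Context: Gerbes are viewed as fibered categories over $\mathcal C$, and functors between fibered categories are morphisms over $\mathcal C$. A sample of $\mathcal C$ is a fibered category $\mathcal S$ over $\mathcal C$ such that for every $S\in\mathcal C$ there is a cover $\{U_i\to S\}$ with $\mathcal S(U_i)\ne\emptyset$ for every $i$. $\mathrm P_{\mathcal H}\to\mathcal H$ is the fibered category of parts of the inertia: an object of $\mathrm P_{\mathcal H}(S)$ is an object $s:S\to\mathcal H$ together with a subsheaf of sets of $\underline{\mathrm{Aut}}_{\mathcal H}(s)$; morphisms are morphisms of $\mathcal H$ identifying the given subsheaf with the pullback of the target subsheaf (via conjugation). For a functor $\psi:X\to\mathrm P_{\mathcal H}$ with composition $f:X\to\mathcal H$, $\psi(x)$ also denotes the corresponding subsheaf of $\underline{\mathrm{Aut}}_{\mathcal H}(f(x))$. A pre-type is a functor $\phi:\mathcal S\to\mathrm P_{\mathcal H}$ from a sample $\mathcal S$, with composition $f:\mathcal S\to\mathrm P_{\mathcal H}\to\mathcal H$, such that for all $S\in\mathcal C$ and $s,s'\in\mathcal S(S)$ there is a cover $\{U_i\to S\}$ and isomorphisms $\alpha_i:f(s_{U_i})\to f(s'_{U_i})$ with $\alpha_i\phi(s_{U_i})\alpha_i^{-1}=\phi(s'_{U_i})$. (Equivalently: for every isomorphism $\alpha:f(s)\Rightarrow f(s')$ in $\mathcal H$, the subsheaf $\alpha^{-1}\phi(s')\alpha$ is locally conjugate to $\phi(s)$ in $\underline{\mathrm{Aut}}_{\mathcal H}(f(s))$.) Two pre-types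 $\phi:\mathcal S\to\mathrm P_{\mathcal H}$, $\phi':\mathcal S'\to\mathrm P_{\mathcal H}$ are equivalent if $\phi\sqcup\phi':\mathcal S\sqcup\mathcal S'\to\mathrm P_{\mathcal H}$ is a pre-type. A type for $\mathcal H$ is an equivalence class of pre-types. If $\Theta$ is a type and $X$ is a fibered category over $\mathcal C$, a functor $\psi:X\to\mathrm P_{\mathcal H}$ is of type $\Theta$ if $\psi\sqcup\phi:X\sqcup\mathcal S\to\mathrm P_{\mathcal H}$ is a pre-type in $\Theta$, where $\phi:\mathcal S\to\mathrm P_{\mathcal H}$ is any pre-type in $\Theta$. *)

(* Defs.v *)
From Corelib Require Import ssreflect ssrfun ssrbool.
From Stdlib Require Import ClassicalEpsilon.

Set Implicit Arguments.
Unset Strict Implicit.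
Unset Printing Implicit Defensive.

Declare Scope fib_scope.
Delimit Scope fib_scope with fib.
Local Open Scope fib_scope.

Record category := Category {
  ob :> Type;
  hom : ob -> ob -> Type;
  idc : forall S, hom S S;
  compc : forall R S T, hom S T -> hom R S -> hom R T;
  compc1 : forall S T (f : hom S T), compc f (idc S) = f;
  comp1c : forall S T (f : hom S T), compc (idc T) f = f;
  compcA : forall Q R S T (h : hom S T) (g : hom R S) (f : hom Q R),
    compc h (compc g f) = compc (compc h g) f }.
Arguments hom {c}.
Arguments idc {c}.
Arguments compc {c R S T}.
Notation "g ∘ f" := (compc g f) (at level 40, left associativity) : fib_scope.

Record sieve (C : category) (S : C) := Sieve {
  sieve_mem :> forall V : C, hom V S -> Prop;
  sieve_comp : forall V W (f : hom V S) (g : hom W V),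
    sieve_mem f -> sieve_mem (f ∘ g) }.

Definition max_sieve (C : category) (S : C) : sieve S :=
  @Sieve C S (fun _ _ => True) (fun _ _ _ _ _ => I).

Definition pull_sieve (C : category) (S T : C) (f : hom S T) (R : sieve T) :
  sieve S.
Proof.
apply: (@Sieve C S (fun V g => R V (f ∘ g))) => V W g h Rfg.
by rewrite compcA; apply: sieve_comp.
Defined.

Record site := Site {
  site_cat :> category;
  covers : forall S : site_cat, sieve S -> Prop;
  covers_max : forall S, covers (max_sieve S);
  covers_pull : forall S T (f : hom S T) (R : sieve T),
    covers R -> covers (pull_sieve f R);
  covers_trans : forall S (R R' : sieve S), covers R ->
    (forall V (f : hom V S), R V f -> covers (pull_sieve f R')) ->
    covers R' }.

Record family (C : category) (S : C) := Family {
  fidx : Type;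
  fdom : fidx -> C;
  farr : forall i, hom (fdom i) S }.
Arguments fidx {C S}.
Arguments fdom {C S}.
Arguments farr {C S}.

Definition gen_sieve (C : category) (S : C) (c : family S) : sieve S.
Proof.
apply: (@Sieve C S (fun V f => exists i (h : hom V (fdom c i)),
  f = farr c i ∘ h)) => V W f g [i [h ->]].
by exists i, (h ∘ g); rewrite compcA.
Defined.

Definition is_cover (C : site) (S : C) (c : family S) : Prop :=
  covers (gen_sieve c).

(* A category with a functor [p] to [C]: [X S] is the collection of the objects
   lying strictly over [S]; [fhom x y] consists of all the arrows from [x] to
   [y], whatever their image [pr u = p u] in [C]. *)
Record overcat (C : category) := OverCat {
  fob :> C -> Type;
  fhom : forall S T : C, fob S -> fob T -> Type;
  pr : forall S T (x : fob S) (y : fob T), fhom x y -> hom S T;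
  fid : forall S (x : fob S), fhom x x;
  fcomp : forall R S T (x : fob R) (y : fob S) (z : fob T),
    fhom y z -> fhom x y -> fhom x z;
  pr_id : forall S (x : fob S), pr (fid x) = idc S;
  pr_comp : forall R S T (x : fob R) (y : fob S) (z : fob T)
    (v : fhom y z) (u : fhom x y), pr (fcomp v u) = pr v ∘ pr u;
  fcomp1 : forall S T (x : fob S) (y : fob T) (u : fhom x y),
    fcomp u (fid x) = u;
  fcomp1f : forall S T (x : fob S) (y : fob T) (u : fhom x y),
    fcomp (fid y) u = u;
  fcompA : forall Q R S T (w : fob Q) (x : fob R) (y : fob S) (z : fob T)
    (a : fhom y z) (b : fhom x y) (c : fhom w x),
    fcomp a (fcomp b c) = fcomp (fcomp a b) c }.
Arguments fhom {C o S T}.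
Arguments pr {C o S T x y}.
Arguments fid {C o S}.
Arguments fcomp {C o R S T x y z}.
Notation "v ⊙ u" := (fcomp v u) (at level 40, left associativity) : fib_scope.

Definition cartesian (C : category) (X : overcat C) (S T : C) (x : X S) (y : X T)
    (u : fhom x y) : Prop :=
  forall R (z : X R) (v : fhom z y) (g : hom R S), pr v = pr u ∘ g ->
    exists! w : fhom z x, pr w = g /\ u ⊙ w = v.

Record fibcat (C : category) := FibCat {
  fibcat_over :> overcat C;
  fib_lift : forall (S T : C) (f : hom S T) (y : fibcat_over T),
    exists (x : fibcat_over S) (u : fhom x y), pr u = f /\ cartesian u }.

Record fibmor (C : category) (X Y : fibcat C) := FibMor {
  mob : forall S, X S -> Y S;
  mhom : forall S T (x : X S) (y : X T), fhom x y -> fhom (mob x) (mob y);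
  mhom_pr : forall S T (x : X S) (y : X T) (u : fhom x y), pr (mhom u) = pr u;
  mhom_id : forall S (x : X S), mhom (fid x) = fid (mob x);
  mhom_comp : forall R S T (x : X R) (y : X S) (z : X T)
    (v : fhom y z) (u : fhom x y), mhom (v ⊙ u) = mhom v ⊙ mhom u;
  mhom_cart : forall S T (x : X S) (y : X T) (u : fhom x y),
    cartesian u -> cartesian (mhom u) }.
Arguments mob {C X Y} f {S} x : rename.
Arguments mhom {C X Y} f {S T x y} u : rename.

Definition fibmor_id (C : category) (X : fibcat C) : fibmor X X.
Proof. exact: (@FibMor C X X (fun _ x => x) (fun _ _ _ _ u => u)). Defined.

Definition fibmor_comp (C : category) (X Y Z : fibcat C)
  (G : fibmor Y Z) (F : fibmor X Y) : fibmor X Z.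
Proof.
apply: (@FibMor C X Z (fun _ x => mob G (mob F x))
                      (fun _ _ _ _ u => mhom G (mhom F u))).
- by move=> *; rewrite !mhom_pr.
- by move=> *; rewrite !mhom_id.
- by move=> *; rewrite !mhom_comp.
- by move=> *; do 2!apply: mhom_cart.
Defined.

Definition faithful (C : category) (X Y : fibcat C) (F : fibmor X Y) : Prop :=
  forall S T (x : X S) (y : X T) (u v : fhom x y),
    mhom F u = mhom F v -> u = v.

Record fiso (C : category) (X : overcat C) (S : C) (x y : X S) := FIso {
  iarr :> fhom x y;
  iinv : fhom y x;
  iarr_pr : pr iarr = idc S;
  iinv_pr : pr iinv = idc S;
  iarrK : iinv ⊙ iarr = fid x;
  iinvK : iarr ⊙ iinv = fid y }.

Lemma fiso_eq (C : category) (X : overcat C) (S : C) (x y : X S)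
  (a b : fiso x y) : iarr a = iarr b -> a = b.
Proof.
case: a b => [a a' pa pa' aK a'K] [b b' pb pb' bK b'K] /= E.
move: E pb bK b'K => <- pb bK b'K.
have E : a' = b'.
  by rewrite -[a']fcomp1 -b'K fcompA aK fcomp1f.
move: E pb' bK b'K => <- pb' bK b'K.
by congr FIso; apply: proof_irrelevance.
Qed.

Definition fiso_id (C : category) (X : overcat C) (S : C) (x : X S) : fiso x x.
Proof.
by apply: (@FIso C X S x x (fid x) (fid x)); rewrite ?pr_id ?fcomp1.
Defined.

Definition fiso_comp (C : category) (X : overcat C) (S : C) (x y z : X S)
  (b : fiso y z) (a : fiso x y) : fiso x z.
Proof.
apply: (@FIso C X S x z (iarr b ⊙ iarr a) (iinv a ⊙ iinv b)).
- by rewrite pr_comp !iarr_pr comp1c.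
- by rewrite pr_comp !iinv_pr comp1c.
- by rewrite fcompA -(fcompA (iinv a)) iarrK fcomp1 iarrK.
- by rewrite fcompA -(fcompA (iarr b)) iinvK fcomp1 iinvK.
Defined.

Definition fiso_inv (C : category) (X : overcat C) (S : C) (x y : X S)
  (a : fiso x y) : fiso y x :=
  FIso (iinv_pr a) (iarr_pr a) (iinvK a) (iarrK a).

Definition mob_fiso (C : category) (X Y : fibcat C) (F : fibmor X Y) (S : C)
  (x y : X S) (a : fiso x y) : fiso (mob F x) (mob F y).
Proof.
apply: (@FIso C Y S _ _ (mhom F (iarr a)) (mhom F (iinv a))).
- by rewrite mhom_pr iarr_pr.
- by rewrite mhom_pr iinv_pr.
- by rewrite -mhom_comp iarrK mhom_id.
- by rewrite -mhom_comp iinvK mhom_id.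
Defined.

Record fibiso (C : category) (X Y : fibcat C) (F G : fibmor X Y) := FibIso {
  niso : forall S (x : X S), fiso (mob F x) (mob G x);
  niso_nat : forall S T (x : X S) (y : X T) (u : fhom x y),
    iarr (niso y) ⊙ mhom F u = mhom G u ⊙ iarr (niso x) }.

(* The notion of isomorphism of gerbes in the 2-category of fibered categories
   over [C]. *)
Definition equivalence (C : category) (X Y : fibcat C) (F : fibmor X Y) : Prop :=
  exists G : fibmor Y X,
    inhabited (fibiso (fibmor_comp G F) (fibmor_id X)) /\
    inhabited (fibiso (fibmor_comp F G) (fibmor_id Y)).

Section Cartesian.
Variables (C : category) (X : overcat C).

Definition fac_sig (R S T : C) (x : X S) (y : X T) (u : fhom x y)
  (cu : cartesian u) (z : X R) (v : fhom z y) (g : hom R S)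
  (e : pr v = pr u ∘ g) : {w : fhom z x | pr w = g /\ u ⊙ w = v}.
Proof.
apply: constructive_indefinite_description.
by case: (cu R z v g e) => w [H _]; exists w.
Qed.

Definition fac (R S T : C) (x : X S) (y : X T) (u : fhom x y)
  (cu : cartesian u) (z : X R) (v : fhom z y) (g : hom R S)
  (e : pr v = pr u ∘ g) : fhom z x := proj1_sig (fac_sig cu e).

Lemma fac_pr (R S T : C) (x : X S) (y : X T) (u : fhom x y)
  (cu : cartesian u) (z : X R) (v : fhom z y) (g : hom R S)
  (e : pr v = pr u ∘ g) : pr (fac cu e) = g.
Proof. by rewrite /fac; case: (fac_sig cu e) => w []. Qed.

Lemma facE (R S T : C) (x : X S) (y : X T) (u : fhom x y)
  (cu : cartesian u) (z : X R) (v : fhom z y) (g : hom R S)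
  (e : pr v = pr u ∘ g) : u ⊙ fac cu e = v.
Proof. by rewrite /fac; case: (fac_sig cu e) => w []. Qed.

Lemma cart_inj (R S T : C) (x : X S) (y : X T) (u : fhom x y) (z : X R)
  (w w' : fhom z x) :
  cartesian u -> pr w = pr w' -> u ⊙ w = u ⊙ w' -> w = w'.
Proof.
move=> cu pw uw.
case: (cu R z (u ⊙ w) (pr w) (pr_comp _ _)) => w0 [_ w0U].
by rewrite -(w0U w) // -(w0U w').
Qed.

Lemma cart_cancel (R S T : C) (x : X R) (y : X S) (z : X T)
  (v : fhom y z) (u : fhom x y) :
  cartesian v -> cartesian (v ⊙ u) -> cartesian u.
Proof.
move=> cv cvu Q t w g e.
have e' : pr (v ⊙ w) = pr (v ⊙ u) ∘ g by rewrite !pr_comp e compcA.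
exists (fac cvu e'); split.
  split; first exact: fac_pr.
  apply: (cart_inj cv); first by rewrite pr_comp fac_pr e.
  by rewrite fcompA facE.
move=> w' [pw' uw']; apply: (cart_inj cvu); first by rewrite fac_pr pw'.
by rewrite facE -fcompA uw'.
Qed.

Lemma cart_fiso (R S : C) (x : X R) (y z : X S) (a : fiso y z)
  (u : fhom x y) : cartesian u -> cartesian (iarr a ⊙ u).
Proof.
move=> cu Q t v g e.
have e' : pr (iinv a ⊙ v) = pr u ∘ g.
  by rewrite pr_comp e pr_comp iinv_pr iarr_pr !comp1c.
exists (fac cu e'); split.
  by rewrite fac_pr -fcompA facE fcompA iinvK fcomp1f.
move=> w [pw wv]; apply: (cart_inj cu); first by rewrite fac_pr.
by rewrite facE -wv !fcompA iarrK fcomp1f.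
Qed.

Lemma base_change_subproof (R S : C) (x' y' : X R) (x y : X S)
  (u : fhom x' x) (v : fhom y' y) (e : pr u = pr v) (a : fiso x y) :
  pr (iarr a ⊙ u) = pr v ∘ idc R.
Proof. by rewrite pr_comp iarr_pr comp1c compc1. Qed.

(* The base change [x' -> y'] of [a : x -> y] along cartesian arrows
   [u : x' -> x] and [v : y' -> y] with the same image in [C]. *)
Definition base_change (R S : C) (x' y' : X R) (x y : X S)
  (u : fhom x' x) (v : fhom y' y) (cu : cartesian u) (cv : cartesian v)
  (e : pr u = pr v) (a : fiso x y) : fiso x' y'.
Proof.
apply: (@FIso C X R x' y' (fac cv (base_change_subproof e a))
                 (fac cu (base_change_subproof (esym e) (fiso_inv a)))).
- exact: fac_pr.
- exact: fac_pr.
- apply: (cart_inj cu); first by rewrite pr_comp !fac_pr pr_id compc1.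
  by rewrite fcompA facE -fcompA facE fcompA iarrK fcomp1f fcomp1.
- apply: (cart_inj cv); first by rewrite pr_comp !fac_pr pr_id compc1.
  by rewrite fcompA facE -fcompA facE fcompA iinvK fcomp1f fcomp1.
Defined.

Lemma base_changeE (R S : C) (x' y' : X R) (x y : X S)
  (u : fhom x' x) (v : fhom y' y) (cu : cartesian u) (cv : cartesian v)
  (e : pr u = pr v) (a : fiso x y) :
  v ⊙ iarr (base_change cu cv e a) = iarr a ⊙ u.
Proof. exact: (facE cv (base_change_subproof e a)). Qed.

End Cartesian.

Section Pullback.
Variables (C : category) (X : fibcat C).

Definition pull_sig (S T : C) (f : hom S T) (y : X T) :
  {x : X S & {u : fhom x y | pr u = f /\ cartesian u}}.
Proof.
have /constructive_indefinite_description [x] := fib_lift f y.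
by move/constructive_indefinite_description => H; exists x.
Qed.

(* [pull f y] is the pullback [f^* y], also written [y_S], and [lift f y] is the
   cartesian arrow [f^* y -> y]. *)
Definition pull (S T : C) (f : hom S T) (y : X T) : X S :=
  projT1 (pull_sig f y).
Definition lift (S T : C) (f : hom S T) (y : X T) : fhom (pull f y) y :=
  proj1_sig (projT2 (pull_sig f y)).

Lemma lift_pr (S T : C) (f : hom S T) (y : X T) : pr (lift f y) = f.
Proof. exact: (proj1 (proj2_sig (projT2 (pull_sig f y)))). Qed.

Lemma lift_cart (S T : C) (f : hom S T) (y : X T) : cartesian (lift f y).
Proof. exact: (proj2 (proj2_sig (projT2 (pull_sig f y)))). Qed.
Arguments lift_cart {S T} f y.

Lemma canon_subproof (S U V : C) (g : hom U S) (a : hom V U) (k : hom V S)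
  (e : g ∘ a = k) (x : X S) : pr (lift k x) = pr (lift g x) ∘ a.
Proof. by rewrite !lift_pr e. Qed.

(* the canonical arrow [(g ∘ a)^* x -> g^* x] over [a] *)
Definition canon (S U V : C) (g : hom U S) (a : hom V U) (k : hom V S)
  (e : g ∘ a = k) (x : X S) : fhom (pull k x) (pull g x) :=
  fac (lift_cart g x) (canon_subproof e x).

Lemma canon_pr (S U V : C) (g : hom U S) (a : hom V U) (k : hom V S)
  (e : g ∘ a = k) (x : X S) : pr (canon e x) = a.
Proof. exact: fac_pr. Qed.

Lemma canonE (S U V : C) (g : hom U S) (a : hom V U) (k : hom V S)
  (e : g ∘ a = k) (x : X S) : lift g x ⊙ canon e x = lift k x.
Proof. exact: facE. Qed.

Lemma canon_cart (S U V : C) (g : hom U S) (a : hom V U) (k : hom V S)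
  (e : g ∘ a = k) (x : X S) : cartesian (canon e x).
Proof.
by apply: (cart_cancel (lift_cart g x)); rewrite canonE; apply: lift_cart.
Qed.
Arguments canon_cart {S U V g a k} e x.

Lemma canon_pr_eq (S U V : C) (g : hom U S) (a : hom V U) (k : hom V S)
  (e : g ∘ a = k) (S' : C) (g' : hom U S') (k' : hom V S') (e' : g' ∘ a = k')
  (x : X S) (y : X S') : pr (canon e x) = pr (canon e' y).
Proof. by rewrite !canon_pr. Qed.

Lemma lift_pr_eq (S U : C) (g : hom U S) (x y : X S) :
  pr (lift g x) = pr (lift g y).
Proof. by rewrite !lift_pr. Qed.

Definition pull_fiso (S U : C) (g : hom U S) (x y : X S) (a : fiso x y) :
  fiso (pull g x) (pull g y) :=
  base_change (lift_cart g x) (lift_cart g y) (lift_pr_eq g x y) a.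

Definition Isom (S : C) (x y : X S) (U : C) (g : hom U S) : Type :=
  fiso (pull g x) (pull g y).

(* restriction along the arrow [a : (V, k) -> (U, g)] of [C/S] *)
Definition res (S U V : C) (x y : X S) (g : hom U S) (a : hom V U)
  (k : hom V S) (e : g ∘ a = k) (s : Isom x y g) : Isom x y k :=
  base_change (canon_cart e x) (canon_cart e y) (canon_pr_eq e e x y) s.

Definition isom_subset (S : C) (x y : X S) : Type :=
  forall (U : C) (g : hom U S), Isom x y g -> Prop.

Definition isom_full (S : C) (x y : X S) : isom_subset x y :=
  fun _ _ _ => True.

Definition eq_subset (S : C) (x y : X S) (P Q : isom_subset x y) : Prop :=
  forall U (g : hom U S) (s : Isom x y g), P U g s <-> Q U g s.

(* [α P α^{-1}], for [P] contained in [Aut(x)] and [α : x -> y] *)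
Definition conj_subset (S : C) (x y : X S) (a : fiso x y)
    (P : isom_subset x x) : isom_subset y y :=
  fun U g s => P U g
    (fiso_comp (fiso_inv (pull_fiso g a)) (fiso_comp s (pull_fiso g a))).

End Pullback.
Arguments canon_cart {C X S U V g a k} e x.
Arguments isom_full {C X S} x y.
Arguments lift_cart {C X S T} f y.

Section Stacks.
Variables (C : site) (X : fibcat C).

(* [P] is a subpresheaf of [Isom(x, y)] which is a sheaf on [C/S] *)
Definition is_sheaf (S : C) (x y : X S) (P : isom_subset x y) : Prop :=
  (forall U V (g : hom U S) (a : hom V U) (k : hom V S) (e : g ∘ a = k)
     (s : Isom x y g), P U g s -> P V k (res e s)) /\
  (forall U (g : hom U S) (c : family U), is_cover c ->
   forall s : forall i, Isom x y (g ∘ farr c i),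
     (forall i, P _ _ (s i)) ->
     (forall i j V (a : hom V (fdom c i)) (b : hom V (fdom c j))
        (k : hom V S) (ea : (g ∘ farr c i) ∘ a = k)
        (eb : (g ∘ farr c j) ∘ b = k), farr c i ∘ a = farr c j ∘ b ->
        res ea (s i) = res eb (s j)) ->
     exists! t : Isom x y g,
       P U g t /\ forall i, res (erefl (g ∘ farr c i)) t = s i).

(* The isomorphism [descent_iso i j V a b] is the value of the gluing
   isomorphism at the [V]-point [(a, b)] of the (possibly not representable)
   fiber product of [U_i] and [U_j] over [S]. *)
Record descent_datum (S : C) (c : family S) := DescentDatum {
  descent_ob : forall i, X (fdom c i);
  descent_iso : forall i j V (a : hom V (fdom c i)) (b : hom V (fdom c j)),
    farr c i ∘ a = farr c j ∘ b ->
    fiso (pull a (descent_ob i)) (pull b (descent_ob j));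
  descent_res : forall i j V W (a : hom V (fdom c i)) (b : hom V (fdom c j))
    (h : hom W V) (e : farr c i ∘ a = farr c j ∘ b)
    (e' : farr c i ∘ (a ∘ h) = farr c j ∘ (b ∘ h)),
    descent_iso e' =
    base_change (canon_cart (erefl (a ∘ h)) (descent_ob i))
                (canon_cart (erefl (b ∘ h)) (descent_ob j))
                (canon_pr_eq _ _ _ _) (descent_iso e);
  descent_cocycle : forall i j k V (a : hom V (fdom c i)) (b : hom V (fdom c j))
    (d : hom V (fdom c k)) (eab : farr c i ∘ a = farr c j ∘ b)
    (ebd : farr c j ∘ b = farr c k ∘ d) (ead : farr c i ∘ a = farr c k ∘ d),
    fiso_comp (descent_iso ebd) (descent_iso eab) = descent_iso ead }.

Definition effective (S : C) (c : family S) (D : descent_datum c) : Prop :=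
  exists (x : X S) (t : forall i, fhom (descent_ob D i) x),
    (forall i, pr (t i) = farr c i /\ cartesian (t i)) /\
    forall i j V (a : hom V (fdom c i)) (b : hom V (fdom c j))
      (e : farr c i ∘ a = farr c j ∘ b),
      t j ⊙ lift b (descent_ob D j) ⊙ descent_iso D e =
      t i ⊙ lift a (descent_ob D i).

(* All the vertical arrows are invertible; it follows that all the arrows are
   cartesian. *)
Definition fibered_in_groupoids : Prop :=
  forall S (x y : X S) (u : fhom x y), pr u = idc S ->
    exists a : fiso x y, iarr a = u.

(* The vertical arrows being invertible, the presheaf of morphisms [x -> y] is
   [Isom(x, y)]. *)
Definition stack_in_groupoids : Prop :=
  [/\ fibered_in_groupoids,
      forall S (x y : X S), is_sheaf (isom_full x y) &
      forall S (c : family S), is_cover c ->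
        forall D : descent_datum c, effective D].

Definition locally_nonempty : Prop :=
  forall S : C, exists c : family S, is_cover c /\
    forall i, inhabited (X (fdom c i)).

Definition locally_connected : Prop :=
  forall S (x y : X S), exists c : family S, is_cover c /\
    forall i, inhabited (fiso (pull (farr c i) x) (pull (farr c i) y)).

End Stacks.

Record gerbe (C : site) := Gerbe {
  gerbe_fib :> fibcat C;
  gerbe_stack : stack_in_groupoids gerbe_fib;
  gerbe_nonempty : locally_nonempty gerbe_fib;
  gerbe_connected : locally_connected gerbe_fib }.

Record aut_subsheaf (C : site) (X : fibcat C) (S : C) (s : X S) := AutSubsheaf {
  sub_sec :> isom_subset s s;
  sub_sheaf : is_sheaf sub_sec }.

Section PullSub.
Variables (C : category) (X : fibcat C).

Lemma transport_subproof (S T U : C) (x : X S) (y : X T) (m : fhom x y)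
  (g : hom U S) :
  pr (m ⊙ lift g x) = pr (lift (pr m ∘ g) y) ∘ idc U.
Proof. by rewrite pr_comp !lift_pr compc1. Qed.

(* for [m : x -> y] over [f], the arrow [g^* x -> (f ∘ g)^* y] induced by [m] *)
Definition transport (S T U : C) (x : X S) (y : X T) (m : fhom x y)
  (g : hom U S) : fhom (pull g x) (pull (pr m ∘ g) y) :=
  fac (lift_cart (pr m ∘ g) y) (transport_subproof m g).

(* The pullback [m^* Q] of [Q], contained in [Aut(y)], along [m : x -> y]: the
   automorphisms of [g^* x] which [transport m g] conjugates into [Q]. *)
Definition pull_subset (S T : C) (x : X S) (y : X T) (m : fhom x y)
    (Q : isom_subset y y) : isom_subset x x :=
  fun U g s => exists t : Isom y y (pr m ∘ g), Q _ _ t /\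
    transport m g ⊙ iarr s = iarr t ⊙ transport m g.

(* The restriction of [P], contained in [Aut(s)], to [U -> S] *)
Definition restrict (S U : C) (s : X S) (g : hom U S) (P : isom_subset s s) :
  isom_subset (pull g s) (pull g s) := pull_subset (lift g s) P.

End PullSub.
Arguments restrict {C X S U s} g P.

Section PartsLemmas.
Variables (C : site) (X : fibcat C) (grX : fibered_in_groupoids X).

Lemma groupoid_fiso S (x y : X S) (u : fhom x y) :
  pr u = idc S -> {a : fiso x y | iarr a = u}.
Proof. by move=> pu; apply: constructive_indefinite_description; apply: grX. Qed.

Lemma groupoid_cart S T (x : X S) (y : X T) (u : fhom x y) : cartesian u.
Proof.
have e : pr u = pr (lift (pr u) y) ∘ idc S by rewrite lift_pr compc1.
have [a aE] := groupoid_fiso (fac_pr (lift_cart (pr u) y) e).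
move=> R z v g ev.
have e' : pr v = pr (lift (pr u) y) ∘ g by rewrite lift_pr.
exists (iinv a ⊙ fac (lift_cart (pr u) y) e'); split.
  split; first by rewrite pr_comp iinv_pr comp1c fac_pr.
  rewrite -[X in X ⊙ _](facE (lift_cart (pr u) y) e) -aE -fcompA.
  by rewrite (fcompA (iarr a)) iinvK fcomp1f facE.
move=> w [pw uw].
have -> : fac (lift_cart (pr u) y) e' = iarr a ⊙ w.
  apply: (cart_inj (lift_cart (pr u) y)).
    by rewrite fac_pr pr_comp iarr_pr comp1c.
  by rewrite facE fcompA aE facE.
by rewrite fcompA iarrK fcomp1f.
Qed.
Arguments groupoid_cart {S T x y} u.

Lemma transport_pr S T U (x : X S) (y : X T) (m : fhom x y) (g : hom U S) :
  pr (transport m g) = idc U.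
Proof. exact: fac_pr. Qed.

Lemma transportE S T U (x : X S) (y : X T) (m : fhom x y) (g : hom U S) :
  lift (pr m ∘ g) y ⊙ transport m g = m ⊙ lift g x.
Proof. exact: facE. Qed.

Lemma resE S U V (x y : X S) (g : hom U S) (a : hom V U) (k : hom V S)
  (e : g ∘ a = k) (s : Isom x y g) :
  canon e y ⊙ res e s = iarr s ⊙ canon e x.
Proof. exact: base_changeE. Qed.

Lemma res_uniq S U V (x y : X S) (g : hom U S) (a : hom V U) (k : hom V S)
  (e : g ∘ a = k) (s : Isom x y g) (t : Isom x y k) :
  canon e y ⊙ iarr t = iarr s ⊙ canon e x -> t = res e s.
Proof.
move=> H; apply/fiso_eq/(cart_inj (canon_cart e y)); first by rewrite !iarr_pr.
by rewrite resE.
Qed.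

(* membership of an automorphism of [t] in the pullback of [Q] along [w] *)
Definition mem_along S U (s : X S) (Q : isom_subset s s) (t : X U)
    (w : fhom t s) (g : fiso t t) : Prop :=
  exists (k : hom U S) (b : Isom s s k) (u : fhom t (pull k s)),
    [/\ pr u = idc U, lift k s ⊙ u = w, u ⊙ iarr g = iarr b ⊙ u & Q U k b].

Lemma pull_subsetE S T (x : X S) (y : X T) (m : fhom x y)
  (Q : isom_subset y y) U (g : hom U S) (s : Isom x x g) :
  pull_subset m Q s <-> mem_along Q (m ⊙ lift g x) s.
Proof.
split.
  case=> t [Qt H]; exists (pr m ∘ g), t, (transport m g).
  by split => //; [exact: transport_pr|exact: transportE].
case=> k [b [u [pu ku ub Qb]]].
have ek : k = pr m ∘ g.
  by move/(congr1 pr): ku; rewrite !pr_comp pu !lift_pr compc1.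
move: ek b u pu ku ub Qb => -> b u pu ku ub Qb; exists b; split => //.
suff -> : transport m g = u by [].
apply: (cart_inj (lift_cart (pr m ∘ g) y)); first by rewrite transport_pr.
by rewrite transportE.
Qed.

Lemma mem_along_pull S T (x : X S) (y : X T) (m : fhom x y)
  (Q : isom_subset y y) U (t : X U) (w : fhom t x) (g : fiso t t) :
  mem_along (pull_subset m Q) w g <-> mem_along Q (m ⊙ w) g.
Proof.
split.
  case=> k [b [u [pu ku ub /pull_subsetE [k' [b' [u' [pu' ku' ub' Qb']]]]]]].
  exists k', b', (u' ⊙ u); split=> //; first by rewrite pr_comp pu pu' comp1c.
    by rewrite fcompA ku' -fcompA ku.
  by rewrite -fcompA ub fcompA ub' fcompA.
case=> k' [b' [u' [pu' ku' ub' Qb']]].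
have e : pr w = pr (lift (pr w) x) ∘ idc U by rewrite lift_pr compc1.
have [a aE] := groupoid_fiso (fac_pr (lift_cart (pr w) x) e).
have aw : lift (pr w) x ⊙ iarr a = w by rewrite aE facE.
have aw' : w ⊙ iinv a = lift (pr w) x.
  by rewrite -[RHS]fcomp1 -(iinvK a) fcompA aw.
exists (pr w), (fiso_comp a (fiso_comp g (fiso_inv a))), (iarr a).
split; rewrite ?iarr_pr //=.
  by rewrite -!fcompA iarrK fcomp1.
apply/pull_subsetE; exists k', b', (u' ⊙ iinv a); split=> //=.
- by rewrite pr_comp pu' iinv_pr comp1c.
- by rewrite fcompA ku' -fcompA aw'.
- by rewrite !fcompA -(fcompA u') iarrK fcomp1 ub'.
Qed.

Lemma mem_along_lift S (s : X S) (Q : isom_subset s s) U (g : hom U S)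
  (t : Isom s s g) : mem_along Q (lift g s) t <-> Q U g t.
Proof.
split; last first.
  move=> Qt; exists g, t, (fid _).
  by rewrite pr_id !fcomp1 fcomp1f.
case=> k [b [u [pu ku ub Qb]]].
have ek : k = g.
  by move/(congr1 pr): ku; rewrite !pr_comp pu !lift_pr compc1.
move: ek b u pu ku ub Qb => -> b u pu ku ub Qb.
have uE : u = fid _.
  apply: (cart_inj (lift_cart g s)); first by rewrite pr_id.
  by rewrite fcomp1.
suff -> : t = b by [].
by apply: fiso_eq; move: ub; rewrite uE fcomp1 fcomp1f.
Qed.

Lemma pull_subset_id S (s : X S) (Q : isom_subset s s) :
  eq_subset Q (pull_subset (fid s) Q).
Proof.
move=> U g t; apply: iff_sym; apply: iff_trans (pull_subsetE _ _ _) _.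
by rewrite fcomp1f; apply: mem_along_lift.
Qed.

Lemma pull_subset_comp R S T (x : X R) (y : X S) (z : X T)
  (n : fhom y z) (m : fhom x y) (Q : isom_subset z z) :
  eq_subset (pull_subset m (pull_subset n Q)) (pull_subset (n ⊙ m) Q).
Proof.
move=> U g t; apply: iff_trans (pull_subsetE _ _ _) _.
apply: iff_trans (mem_along_pull _ _ _ _) _.
by rewrite fcompA; apply: iff_sym; apply: pull_subsetE.
Qed.

Lemma eq_pull_subset S T (x : X S) (y : X T) (m : fhom x y)
  (P Q : isom_subset y y) :
  eq_subset P Q -> eq_subset (pull_subset m P) (pull_subset m Q).
Proof.
move=> PQ U g s; split; case=> t [Ht H]; exists t; split=> //.
- exact: (proj1 (PQ _ _ _)).
- exact: (proj2 (PQ _ _ _)).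
Qed.

Lemma transport_canon S T U V (x : X S) (y : X T) (m : fhom x y)
  (g : hom U S) (a : hom V U) (k : hom V S) (e : g ∘ a = k)
  (l : hom U T) (k' : hom V T) (e' : l ∘ a = k')
  (u : fhom (pull g x) (pull l y)) (u' : fhom (pull k x) (pull k' y)) :
  pr u = idc U -> pr u' = idc V ->
  lift l y ⊙ u = m ⊙ lift g x -> lift k' y ⊙ u' = m ⊙ lift k x ->
  canon e' y ⊙ u' = u ⊙ canon e x.
Proof.
move=> pu pu' lu lu'; apply: (cart_inj (lift_cart l y)).
  by rewrite !pr_comp pu pu' !canon_pr comp1c compc1.
by rewrite !fcompA canonE lu lu' -fcompA canonE.
Qed.

Lemma pull_subset_sheaf S T (x : X S) (y : X T) (m : fhom x y)
  (Q : isom_subset y y) : is_sheaf Q -> is_sheaf (pull_subset m Q).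
Proof.
move=> [Qres Qglue].
have comparison U (g : hom U S) (l : hom U T) : l = pr m ∘ g ->
    {u : fiso (pull g x) (pull l y) | lift l y ⊙ iarr u = m ⊙ lift g x}.
  move=> ->; have [a aE] := groupoid_fiso (transport_pr m g).
  by exists a; rewrite aE transportE.
have memE U (g : hom U S) (l : hom U T) (u : fiso (pull g x) (pull l y))
    (s : Isom x x g) : lift l y ⊙ iarr u = m ⊙ lift g x ->
    pull_subset m Q s <->
    Q U l (fiso_comp u (fiso_comp s (fiso_inv u))).
  move=> lu; apply: iff_trans (pull_subsetE _ _ _) _.
  rewrite -lu; split.
    case=> k [b [v [pv kv vb Qb]]].
    have ek : k = l.
      move/(congr1 pr): kv.
      by rewrite !pr_comp pv iarr_pr !lift_pr !compc1.
    move: ek b v pv kv vb Qb => -> b v pv kv vb Qb.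
    have vE : v = iarr u.
      by apply: (cart_inj (lift_cart l y)); rewrite ?pv ?iarr_pr.
    suff -> : fiso_comp u (fiso_comp s (fiso_inv u)) = b by [].
    by apply: fiso_eq => /=; rewrite fcompA -vE vb vE -fcompA iinvK fcomp1.
  move=> Qs; exists l, (fiso_comp u (fiso_comp s (fiso_inv u))), (iarr u).
  by split=> //=; rewrite ?iarr_pr // -!fcompA iarrK fcomp1.
have conj_res U V (g : hom U S) (a : hom V U) (k : hom V S) (e : g ∘ a = k)
    (l : hom U T) (k' : hom V T) (e' : l ∘ a = k')
    (u : fiso (pull g x) (pull l y)) (v : fiso (pull k x) (pull k' y))
    (s : Isom x x g) :
    lift l y ⊙ iarr u = m ⊙ lift g x -> lift k' y ⊙ iarr v = m ⊙ lift k x ->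
    fiso_comp v (fiso_comp (res e s) (fiso_inv v)) =
    res e' (fiso_comp u (fiso_comp s (fiso_inv u))).
  move=> lu lv; apply: res_uniq => /=.
  have uv := transport_canon e e' (iarr_pr u) (iarr_pr v) lu lv.
  have uv' : iinv u ⊙ canon e' y = canon e x ⊙ iinv v.
    rewrite -[canon e' y]fcomp1 -(iinvK v) (fcompA _ _ (iinv v)) uv.
    by rewrite !fcompA iarrK fcomp1f.
  by rewrite -!fcompA uv' !fcompA uv -(fcompA _ (canon e x)) resE !fcompA.
have conj_inj U (g : hom U S) (l : hom U T) (u : fiso (pull g x) (pull l y))
    (s t : Isom x x g) :
    fiso_comp u (fiso_comp s (fiso_inv u)) =
    fiso_comp u (fiso_comp t (fiso_inv u)) -> s = t.
  move=> E; apply: fiso_eq.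
  have /= := congr1 (fun z => iinv u ⊙ iarr z ⊙ iarr u) E.
  by rewrite !fcompA iarrK !fcomp1f -!fcompA iarrK !fcomp1.
split.
  move=> U V g a k e s.
  have [u lu] := comparison U g _ erefl.
  have e' : (pr m ∘ g) ∘ a = pr m ∘ k by rewrite -compcA e.
  have [v lv] := comparison V k _ erefl.
  move/(memE _ _ _ _ _ lu) => Qs; apply/(memE _ _ _ _ _ lv).
  by rewrite (conj_res _ _ _ _ _ e _ _ e' u v s lu lv); apply: Qres.
move=> U g c cc s Ps smatch.
have [u lu] := comparison U g _ erefl.
pose vs i := comparison _ (g ∘ farr c i) ((pr m ∘ g) ∘ farr c i)
  (esym (compcA _ _ _)).
pose v i := proj1_sig (vs i).
have lv i : lift ((pr m ∘ g) ∘ farr c i) y ⊙ iarr (v i) =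
    m ⊙ lift (g ∘ farr c i) x := proj2_sig (vs i).
have [|i j V a b k' ea eb eab|t [[Qt tres] tU]] := Qglue U (pr m ∘ g) c cc
  (fun i => fiso_comp (v i) (fiso_comp (s i) (fiso_inv (v i)))).
- by move=> i; apply/(memE _ _ _ _ _ (lv i)).
- have ek' : k' = pr m ∘ (g ∘ farr c i ∘ a) by rewrite -ea !compcA.
  have [w lw] := comparison V (g ∘ farr c i ∘ a) k' ek'.
  have eb' : g ∘ farr c j ∘ b = g ∘ farr c i ∘ a by rewrite -!compcA eab.
  rewrite -(conj_res _ _ _ _ _ erefl _ _ ea _ w (s i) (lv i) lw).
  rewrite -(conj_res _ _ _ _ _ eb' _ _ eb _ w (s j) (lv j) lw).
  by rewrite (smatch i j V a b _ erefl eb' eab).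
- pose t0 : Isom x x g := fiso_comp (fiso_inv u) (fiso_comp t u).
  have t0K : fiso_comp u (fiso_comp t0 (fiso_inv u)) = t.
    by apply: fiso_eq; rewrite /= !fcompA iinvK fcomp1f -!fcompA iinvK fcomp1.
  exists t0; split.
    split; first by apply/(memE _ _ _ _ _ lu); rewrite t0K.
    move=> i; apply: (conj_inj _ _ _ (v i)).
    by rewrite (conj_res _ _ _ _ _ erefl _ _ erefl u (v i) t0 lu (lv i)) t0K tres.
  move=> t1 [Pt1 t1res]; apply: (conj_inj _ _ _ u); rewrite t0K; apply: tU.
  split; first exact/(memE _ _ _ _ _ lu).
  move=> i.
  by rewrite -(conj_res _ _ _ _ _ erefl _ _ erefl u (v i) t1 lu (lv i)) t1res.
Qed.

End PartsLemmas.
Arguments groupoid_cart {C X} grX {S T x y} u.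

Section Parts.
Variables (C : site) (H : gerbe C).

Let grH : fibered_in_groupoids H.
Proof. by case: (gerbe_stack H). Qed.

Record parts_ob (S : C) := PartsOb {
  parts_base : H S;
  parts_sub : aut_subsheaf parts_base }.

Record parts_hom (S T : C) (x : parts_ob S) (y : parts_ob T) := PartsHom {
  parts_arr : fhom (parts_base x) (parts_base y);
  parts_arrP :
    eq_subset (parts_sub x) (pull_subset parts_arr (parts_sub y)) }.

Lemma parts_hom_eq (S T : C) (x : parts_ob S) (y : parts_ob T)
  (u v : parts_hom x y) : parts_arr u = parts_arr v -> u = v.
Proof.
case: u v => [u Hu] [v Hv] /= E; move: E Hv => <- Hv.
by congr PartsHom; apply: proof_irrelevance.
Qed.

Definition parts_id (S : C) (x : parts_ob S) : parts_hom x x :=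
  PartsHom (pull_subset_id (parts_sub x)).

Definition parts_comp (Q R S : C) (x : parts_ob Q) (y : parts_ob R)
  (z : parts_ob S) (v : parts_hom y z) (u : parts_hom x y) : parts_hom x z.
Proof.
apply: (@PartsHom _ _ x z (parts_arr v ⊙ parts_arr u)) => U g s.
apply: iff_trans (parts_arrP u s) _.
apply: iff_trans (eq_pull_subset _ (parts_arrP v) s) _.
exact: (pull_subset_comp grH).
Defined.

Definition parts_over : overcat C.
Proof.
apply: (@OverCat C parts_ob parts_hom (fun _ _ _ _ u => pr (parts_arr u))
  parts_id parts_comp).
- by move=> *; apply: pr_id.
- by move=> *; apply: pr_comp.
- by move=> *; apply: parts_hom_eq; apply: fcomp1.
- by move=> *; apply: parts_hom_eq; apply: fcomp1f.
- by move=> *; apply: parts_hom_eq; apply: fcompA.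
Defined.

Lemma parts_cart (S T : C) (x : parts_over S) (y : parts_over T)
  (u : fhom x y) : cartesian u.
Proof.
move=> R z v g e.
have cu := groupoid_cart grH (parts_arr u).
have vE := facE cu e.
have Hw : eq_subset (parts_sub z) (pull_subset (fac cu e) (parts_sub x)).
  move=> U h s; apply: iff_trans (parts_arrP v s) _.
  rewrite -[X in pull_subset X _]vE.
  apply: iff_trans (iff_sym (pull_subset_comp grH _ _ _ s)) _.
  apply: iff_sym; apply: eq_pull_subset; exact: (parts_arrP u).
exists (PartsHom Hw : @fhom C parts_over _ _ z x); split.
  by split; [exact: fac_pr|exact: parts_hom_eq].
move=> w [pw uw]; apply: parts_hom_eq => /=; apply: (cart_inj cu).
  by rewrite fac_pr.
by rewrite facE -uw.
Qed.

Lemma parts_lift (S T : C) (f : hom S T) (y : parts_over T) :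
  exists (x : parts_over S) (u : fhom x y), pr u = f /\ cartesian u.
Proof.
pose m := lift f (parts_base y).
pose P := AutSubsheaf (pull_subset_sheaf grH m (sub_sheaf (parts_sub y))).
have HP : eq_subset P (pull_subset m (parts_sub y)) by [].
exists (PartsOb P), (@PartsHom _ _ (PartsOb P) y m HP).
by split; [exact: lift_pr|exact: parts_cart].
Qed.

(* the fibered category of parts of the inertia, [P_H] *)
Definition parts : fibcat C := FibCat parts_lift.

Definition parts_forget : fibmor parts H.
Proof.
apply: (@FibMor C parts H parts_base (fun _ _ _ _ u => parts_arr u)) => //.
by move=> S T x y u _; apply: (groupoid_cart grH).
Defined.

End Parts.

Section Coproduct.
Variables (C : category) (X Y : fibcat C).

Definition coprod_ob (S : C) : Type := (X S + Y S)%type.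

Definition coprod_hom (S T : C) (x : coprod_ob S) (y : coprod_ob T) : Type :=
  match x, y with
  | inl x, inl y => fhom x y
  | inr x, inr y => fhom x y
  | _, _ => Empty_set
  end.

Definition coprod_pr (S T : C) (x : coprod_ob S) (y : coprod_ob T) :
  coprod_hom x y -> hom S T :=
  match x, y with
  | inl x, inl y => fun u => pr u
  | inr x, inr y => fun u => pr u
  | _, _ => fun u => match u with end
  end.

Definition coprod_id (S : C) (x : coprod_ob S) : coprod_hom x x :=
  match x with inl x => fid x | inr x => fid x end.

Definition coprod_comp (R S T : C) (x : coprod_ob R) (y : coprod_ob S)
  (z : coprod_ob T) : coprod_hom y z -> coprod_hom x y -> coprod_hom x z.
Proof.
by case: x y z => [x|x] [y|y] [z|z] //= v u; exact: (v ⊙ u).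
Defined.

Definition coprod_over : overcat C.
Proof.
apply: (@OverCat C coprod_ob coprod_hom coprod_pr coprod_id coprod_comp).
- by move=> S [x|x]; apply: pr_id.
- by move=> R S T [x|x] [y|y] [z|z] //= v u; apply: pr_comp.
- by move=> S T [x|x] [y|y] //= u; apply: fcomp1.
- by move=> S T [x|x] [y|y] //= u; apply: fcomp1f.
- by move=> Q R S T [w|w] [x|x] [y|y] [z|z] //= a b c; apply: fcompA.
Defined.

Lemma coprod_inl_cart (S T : C) (x : X S) (y : X T) (u : fhom x y) :
  cartesian u <->
  cartesian (u : @fhom C coprod_over S T (inl x) (inl y)).
Proof.
split=> cu R z; last exact: (cu R (inl z)).
by case: z => [z|z] v g e; [exact: (cu R z v g e)|case: v e].
Qed.

Lemma coprod_inr_cart (S T : C) (x : Y S) (y : Y T) (u : fhom x y) :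
  cartesian u <->
  cartesian (u : @fhom C coprod_over S T (inr x) (inr y)).
Proof.
split=> cu R z; last exact: (cu R (inr z)).
by case: z => [z|z] v g e; [case: v e|exact: (cu R z v g e)].
Qed.

Lemma coprod_lift (S T : C) (f : hom S T) (y : coprod_over T) :
  exists (x : coprod_over S) (u : fhom x y), pr u = f /\ cartesian u.
Proof.
case: y => y; have [x [u [pu cu]]] := fib_lift f y.
- by exists (inl x), u; split=> //; apply/coprod_inl_cart.
- by exists (inr x), u; split=> //; apply/coprod_inr_cart.
Qed.

Definition coprod : fibcat C := FibCat coprod_lift.

Variables (Z : fibcat C) (F : fibmor X Z) (G : fibmor Y Z).

Definition copair_ob (S : C) (x : coprod S) : Z S :=
  match x with inl x => mob F x | inr x => mob G x end.

Definition copair_hom (S T : C) (x : coprod S) (y : coprod T) :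
  fhom x y -> fhom (copair_ob x) (copair_ob y) :=
  match x, y return @fhom C coprod S T x y ->
                    fhom (copair_ob x) (copair_ob y) with
  | inl x, inl y => fun u => mhom F u
  | inr x, inr y => fun u => mhom G u
  | _, _ => fun u => match u with end
  end.

Definition copair : fibmor coprod Z.
Proof.
apply: (@FibMor C coprod Z copair_ob copair_hom).
- by move=> S T [x|x] [y|y] //= u; apply: mhom_pr.
- by move=> S [x|x] //=; apply: mhom_id.
- by move=> R S T [x|x] [y|y] [z|z] //= v u; apply: mhom_comp.
- move=> S T [x|x] [y|y] //= u cu; apply: mhom_cart.
  + exact/coprod_inl_cart.
  + exact/coprod_inr_cart.
Defined.

End Coproduct.

Section Types.
Variables (C : site) (H : gerbe C).

Definition underlying (X : fibcat C) (psi : fibmor X (parts H)) : fibmor X H :=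
  fibmor_comp (parts_forget H) psi.

(* the subsheaf [ψ(x)] of [Aut(f(x))] *)
Definition part_of (X : fibcat C) (psi : fibmor X (parts H)) (S : C) (x : X S) :
  aut_subsheaf (mob (underlying psi) x) := parts_sub (mob psi x).

Definition is_pretype (X : fibcat C) (phi : fibmor X (parts H)) : Prop :=
  locally_nonempty X /\
  forall S (s s' : X S), exists c : family S, is_cover c /\
    forall i, exists a : fiso (mob (underlying phi) (pull (farr c i) s))
                              (mob (underlying phi) (pull (farr c i) s')),
      eq_subset (conj_subset a (part_of phi (pull (farr c i) s)))
                (part_of phi (pull (farr c i) s')).

Record pretype := PreType {
  pre_sample : fibcat C;
  pre_mor :> fibmor pre_sample (parts H);
  pre_ok : is_pretype pre_mor }.

Definition pretype_equiv (phi phi' : pretype) : Prop :=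
  is_pretype (copair phi phi').

Record type_for := TypeFor {
  in_type :> pretype -> Prop;
  in_typeP : exists phi0, forall phi, in_type phi <-> pretype_equiv phi0 phi }.

Definition of_type (Theta : type_for) (X : fibcat C)
    (psi : fibmor X (parts H)) : Prop :=
  forall phi : pretype, Theta phi ->
    exists ok : is_pretype (copair psi phi), Theta (PreType ok).

End Types.
Arguments pre_sample {C H}.

Section Normalizer.
Variables (C : site) (H N : gerbe C) (nu : fibmor N H).
Variables (X : fibcat C) (psi : fibmor X (parts H)) (mu : fibmor X N).
Variable theta : fibiso (fibmor_comp nu mu) (underlying psi).

Lemma comparison_cart S U (g : hom U S) (x : X S) :
  cartesian (mhom nu (lift g (mob mu x))).
Proof. exact/mhom_cart/lift_cart. Qed.
Arguments comparison_cart {S U} g x.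

Lemma comparison_pr S U (g : hom U S) (x : X S) :
  pr (mhom nu (lift g (mob mu x))) = pr (lift g (mob (underlying psi) x)).
Proof. by rewrite mhom_pr !lift_pr. Qed.

(* the isomorphism [ν(g^* μ(x)) -> g^* f(x)] induced by [θ : ν ∘ μ -> f] *)
Definition comparison S U (g : hom U S) (x : X S) :
  fiso (mob nu (pull g (mob mu x))) (pull g (mob (underlying psi) x)) :=
  base_change (comparison_cart g x) (lift_cart g (mob (underlying psi) x))
              (comparison_pr g x) (niso theta x).

(* the map [Isom_N(μ(x), μ(y)) -> Isom_H(f(x), f(y))] induced by [ν] and [θ] *)
Definition isom_map S (x y : X S) U (g : hom U S)
    (b : Isom (mob mu x) (mob mu y) g) :
  Isom (mob (underlying psi) x) (mob (underlying psi) y) g :=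
  fiso_comp (comparison g y)
    (fiso_comp (mob_fiso nu b) (fiso_inv (comparison g x))).

(* isomorphisms [α] such that [α^{-1} ψ(y) α = ψ(x)] *)
Definition isom_of_parts S (x y : X S) :
    isom_subset (mob (underlying psi) x) (mob (underlying psi) y) :=
  fun U g a =>
    eq_subset (conj_subset (fiso_inv a) (restrict g (part_of psi y)))
              (restrict g (part_of psi x)).

Definition normalizing_factorization : Prop :=
  forall S (x y : X S) U (g : hom U S),
    injective (@isom_map S x y U g) /\
    forall a : Isom (mob (underlying psi) x) (mob (underlying psi) y) g,
      (exists b, isom_map b = a) <-> isom_of_parts a.

End Normalizer.

Definition normalizer_subset (C : category) (X : fibcat C) (S : C) (s : X S)
    (P : isom_subset s s) : isom_subset s s :=
  fun U g a => eq_subset (conj_subset a (restrict g P)) (restrict g P).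

(* Main.v *)
From Corelib Require Import ssreflect ssrfun ssrbool.
From Stdlib Require Import ClassicalEpsilon FunctionalExtensionality.
From Stdlib Require Import PropExtensionality.
Require Import Defs.
Set Implicit Arguments.
Unset Strict Implicit.
Unset Printing Implicit Defensive.
Set Bullet Behavior "None".
Local Open Scope fib_scope.

(* Since subsheaves glue, [parts H] is a stack; the normalizer of the class of a
   pre-type [phi] is its full substack of objects locally isomorphic to values
   of [phi], and the definition of a pre-type says precisely that this substack
   is a gerbe.  For uniqueness, an object [n] of a normalizer [N] is determined
   by the set of arrows [f s -> nu n] of [H] that lift to arrows [mu s -> n].
   Two normalizers are compared by matching the objects that have the same
   image in [H] and the same set of arrows: a match exists by descent along
   [nu'], and arrows of [H] compatible with these sets lift uniquely, so that
   choosing a match for every object is automatically functorial. *)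

(** * Descent for arrows *)

(** The definitions use chosen pullbacks, which are not strict: [pull (idc S) x] need not be [x], an
    iterated pullback need not be the pullback along the composite, and a functor need not preserve
    the choices. The proof therefore restates the sheaf and descent conditions on all arrows. In a
    category fibered in groupoids every arrow is cartesian, so a restriction of [x] is any arrow
    into [x], and an overlap of two pieces is any object mapping compatibly to both. For uniqueness
    no arrow between the two normalizers is given beforehand. They can be compared because an object
    [n] is locally isomorphic to values of [mu], and because, once one arrow [w] to [mob nu n]
    lifts, whether [w ⊙ w0] lifts is a condition on [w0] that involves [psi] alone. *)

Section Sites.
Variable C : site.

Lemma sieve_eq (S : C) (R R' : sieve S) :
  (forall V (f : hom V S), R V f <-> R' V f) -> R = R'.
Proof.
case: R R' => [R Rc] [R' Rc'] /= RR'.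
have E : R = R'.
  apply: functional_extensionality_dep => V.
  apply: functional_extensionality_dep => f.
  exact/propositional_extensionality/RR'.
by move: E Rc' {RR'} => <- Rc'; congr Sieve; apply: proof_irrelevance.
Qed.

Lemma covers_sub (S : C) (R R' : sieve S) :
  covers R -> (forall V (f : hom V S), R V f -> R' V f) -> covers R'.
Proof.
move=> cR RR'; apply: (covers_trans cR) => V f Rf.
have -> : pull_sieve f R' = max_sieve V; last exact: covers_max.
by apply: sieve_eq => W g; split=> // _; apply/RR'/sieve_comp.
Qed.

Lemma covers_local (S : C) (c : family S) (R : sieve S) :
  is_cover c -> (forall i, covers (pull_sieve (farr c i) R)) -> covers R.
Proof.
move=> cc cR; apply: (covers_trans cc) => V _ [i [h ->]].
apply: (covers_sub (covers_pull h (cR i))) => W g /=.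
by rewrite compcA.
Qed.

(** The sheaf and stack conditions quantify over families, the axioms of a site over sieves; listing
    the members of a sieve connects the two. *)
Definition sieve_family (S : C) (R : sieve S) : family S :=
  @Family C S {V : C & {f : hom V S | R V f}} (@projT1 _ _)
    (fun i => proj1_sig (projT2 i)).

Lemma sieve_family_cover (S : C) (R : sieve S) :
  covers R -> is_cover (sieve_family R).
Proof.
move=> cR; apply: (covers_sub cR) => V f Rf.
by exists (existT _ V (exist _ f Rf)), (idc V); rewrite compc1.
Qed.

End Sites.

Section Arrows.
Variables (C : site) (X : fibcat C) (grX : fibered_in_groupoids X).

Lemma factor R S T (x : X S) (y : X T) (z : X R) (u : fhom x y)
  (v : fhom z y) (g : hom R S) :
  pr v = pr u ∘ g -> exists w : fhom z x, pr w = g /\ u ⊙ w = v.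
Proof.
move=> e; have cu := groupoid_cart grX u.
by exists (fac cu e); rewrite fac_pr facE.
Qed.

Lemma arrow_inj R S T (x : X S) (y : X T) (z : X R) (u : fhom x y)
  (w w' : fhom z x) : pr w = pr w' -> u ⊙ w = u ⊙ w' -> w = w'.
Proof. exact/cart_inj/groupoid_cart. Qed.

Lemma factor_fiso S T (x z : X S) (y : X T) (u : fhom x y) (v : fhom z y) :
  pr v = pr u -> exists a : fiso z x, u ⊙ iarr a = v.
Proof.
move=> e; have [|w [pw uw]] := @factor _ _ _ _ _ _ u v (idc S).
  by rewrite compc1.
by have [a aE] := groupoid_fiso grX pw; exists a; rewrite aE.
Qed.

(** Separatedness of [Isom], tested on every arrow into [x] above the sieve instead of chosen
    pullbacks; in this form it passes along faithful functors. *)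
Definition arrows_separated : Prop :=
  forall S T (x : X S) (y : X T) (R : sieve S) (w w' : fhom x y),
  covers R -> pr w = pr w' ->
  (forall V (z : X V) (p : fhom z x), R V (pr p) -> w ⊙ p = w' ⊙ p) -> w = w'.

(* Descent for arrows without chosen pullbacks: the restriction of the arrow
   [x -> y] to [U_i] is presented as a span [x <- z_i -> y]. *)
Definition arrows_glue : Prop :=
  forall S T (k : hom S T) (x : X S) (y : X T) (c : family S)
    (z : forall i, X (fdom c i))
    (p : forall i, fhom (z i) x) (q : forall i, fhom (z i) y),
  is_cover c -> (forall i, pr (p i) = farr c i) ->
  (forall i, pr (q i) = k ∘ farr c i) ->
  (forall i j V (t : X V) (a : fhom t (z i)) (b : fhom t (z j)),
    p i ⊙ a = p j ⊙ b -> q i ⊙ a = q j ⊙ b) ->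
  exists w : fhom x y, pr w = k /\ forall i, w ⊙ p i = q i.

Lemma res_lift S U V (x y : X S) (g : hom U S) (a : hom V U) (k : hom V S)
  (e : g ∘ a = k) (s : Isom x y g) :
  lift k y ⊙ iarr (res e s) = lift g y ⊙ iarr s ⊙ canon e x.
Proof. by rewrite -(canonE e) -!fcompA resE. Qed.

Lemma fiso_lift_eq S U (g : hom U S) (y : X S) (z : X U)
  (s t : fiso z (pull g y)) : lift g y ⊙ iarr s = lift g y ⊙ iarr t -> s = t.
Proof.
by move=> E; apply/fiso_eq/(arrow_inj _ E); rewrite !iarr_pr.
Qed.

Lemma res_res S U V W (x y : X S) (g : hom U S) (a : hom V U) (k : hom V S)
  (e : g ∘ a = k) (b : hom W V) (l : hom W S) (e' : k ∘ b = l)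
  (e'' : g ∘ (a ∘ b) = l) (s : Isom x y g) :
  res e' (res e s) = res e'' s.
Proof.
apply: fiso_lift_eq; rewrite !res_lift -!fcompA; congr (_ ⊙ (_ ⊙ _)).
apply: (arrow_inj (u := lift g x)); first by rewrite pr_comp !canon_pr.
by rewrite fcompA !canonE.
Qed.

Section FromSheaf.
Hypothesis shX : forall S (x y : X S), is_sheaf (isom_full x y).

(** Both [s] and [t] glue the restrictions of [s], so the uniqueness clause of the sheaf condition
    identifies them. *)
Lemma isom_separated S U (x y : X S) (g : hom U S) (c : family U)
  (s t : Isom x y g) : is_cover c ->
  (forall i, res (erefl (g ∘ farr c i)) s = res erefl t) -> s = t.
Proof.
move=> cc st; have [_ gl] := shX x y.
have [|i j V a b k ea eb ab|r [_ rU]] :=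
  gl U g c cc (fun i => res erefl s); first by [].
  have ea' : g ∘ (farr c i ∘ a) = k by rewrite compcA.
  have eb' : g ∘ (farr c j ∘ b) = k by rewrite compcA.
  rewrite (res_res _ _ ea') (res_res _ _ eb').
  by move: ab ea' eb' => -> ea' eb'; congr res; apply: proof_irrelevance.
by rewrite -(rU s) // (rU t) //; split.
Qed.

(** Factoring through a lift of [y] leaves two vertical arrows. Sections of [Isom] over [idc S] live
    between pullbacks along [idc S], so these arrows are compared there and recovered through
    [j]. *)
Lemma stack_separated : arrows_separated.
Proof.
move=> S T x y R w w' cR pw ww'.
have pwl : pr w = pr (lift (pr w) y) by rewrite lift_pr.
have pwl' : pr w' = pr (lift (pr w) y) by rewrite lift_pr.
have [a aE] := factor_fiso pwl; have [a' aE'] := factor_fiso pwl'.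
rewrite -aE -aE'; congr (_ ⊙ _).
have {}ww' V (z : X V) (p : fhom z x) : R V (pr p) -> iarr a ⊙ p = iarr a' ⊙ p.
  move=> Rp; apply: (arrow_inj (u := lift (pr w) y)).
    by rewrite !pr_comp !iarr_pr.
  by rewrite !fcompA aE aE'; apply: ww'.
have lE (d : fiso x (pull (pr w) y)) :
    lift (idc S) _ ⊙ iarr (pull_fiso (idc S) d) = iarr d ⊙ lift (idc S) x.
  exact: base_changeE.
have E : pull_fiso (idc S) a = pull_fiso (idc S) a'.
  apply: (isom_separated (sieve_family_cover cR)) => i.
  apply: fiso_lift_eq; rewrite !res_lift !lE -!fcompA canonE.
  apply: ww'; rewrite lift_pr comp1c; exact: (proj2_sig (projT2 i)).
have [j jE] : exists j : fiso x (pull (idc S) x), lift (idc S) x ⊙ iarr j = fid x.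
  by apply: factor_fiso; rewrite pr_id lift_pr.
rewrite -[iarr a]fcomp1 -[iarr a']fcomp1 -jE !fcompA -!lE.
by rewrite E.
Qed.

Lemma glue_vertical S (x y : X S) (c : family S)
    (z : forall i, X (fdom c i))
    (p : forall i, fhom (z i) x) (q : forall i, fhom (z i) y) :
  is_cover c -> (forall i, pr (p i) = farr c i) ->
  (forall i, pr (q i) = farr c i) ->
  (forall i j V (t : X V) (a : fhom t (z i)) (b : fhom t (z j)),
    p i ⊙ a = p j ⊙ b -> q i ⊙ a = q j ⊙ b) ->
  exists w : fhom x y, pr w = idc S /\ forall i, w ⊙ p i = q i.
Proof.
move=> cc pp pq pqE; have [_ gl] := shX x y.
(* The span through [z i] defines a section of [Isom] over [farr c i]. It is pinned down by its
   effect on all pairs [d], [e] with the same composite to [x], so that overlaps can be tested on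
   arbitrary objects [t]. *)
have s_sig i : {s : Isom x y (idc S ∘ farr c i) |
    forall V (t : X V) (d : fhom t (z i)) (e : fhom t (pull _ x)),
    pr d = pr e -> p i ⊙ d = lift _ x ⊙ e ->
    lift _ y ⊙ iarr s ⊙ e = q i ⊙ d}.
  apply: constructive_indefinite_description.
  have [|j jE] := @factor_fiso _ _ _ (pull (idc S ∘ farr c i) x) _ (p i)
    (lift _ x); first by rewrite lift_pr pp comp1c.
  have [|s sE] := @factor_fiso _ _ _ _ _ (lift (idc S ∘ farr c i) y)
    (q i ⊙ iarr j).
    by rewrite lift_pr pr_comp pq iarr_pr comp1c compc1.
  exists s => V t d e pde de; rewrite sE -fcompA; congr (_ ⊙ _).
  apply: (arrow_inj (u := p i)); last by rewrite fcompA jE de.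
  by rewrite pr_comp iarr_pr comp1c.
have [s sE] : exists s : forall i, Isom x y (idc S ∘ farr c i), forall i,
    forall V (t : X V) (d : fhom t (z i)) (e : fhom t (pull _ x)),
    pr d = pr e -> p i ⊙ d = lift _ x ⊙ e ->
    lift _ y ⊙ iarr (s i) ⊙ e = q i ⊙ d.
  by exists (fun i => proj1_sig (s_sig i)) => i; apply: (proj2_sig (s_sig i)).
have [|i j V a b k ea eb ab|t [[_ tE] _]] := gl S (idc S) c cc s.
- by [].
- have [|d [pd dE]] := @factor _ _ _ _ _ _ (p i) (lift k x) a.
    by rewrite lift_pr pp -ea comp1c.
  have [|d' [pd' dE']] := @factor _ _ _ _ _ _ (p j) (lift k x) b.
    by rewrite lift_pr pp -eb comp1c.
  apply: fiso_lift_eq; rewrite !res_lift.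
  rewrite (sE i _ _ d) ?canon_pr ?canonE //.
  rewrite (sE j _ _ d') ?canon_pr ?canonE //.
  by apply: pqE; rewrite dE dE'.
- have [j jE] : exists j : fiso x (pull (idc S) x),
      lift (idc S) x ⊙ iarr j = fid x.
    by apply: factor_fiso; rewrite pr_id lift_pr.
  exists (lift (idc S) y ⊙ iarr t ⊙ iarr j); split.
    by rewrite !pr_comp !iarr_pr lift_pr !comp1c.
  move=> i.
  have [|e eE] := @factor_fiso _ _ _ _ _ (lift (idc S ∘ farr c i) x) (p i).
    by rewrite lift_pr pp comp1c.
  rewrite -[RHS]fcomp1 -(sE i _ _ (fid _) (iarr e)) ?fcomp1 ?pr_id ?iarr_pr //.
  rewrite -tE res_lift -!fcompA; congr (_ ⊙ (_ ⊙ _)).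
  apply: (arrow_inj (u := lift (idc S) x)).
    by rewrite !pr_comp !iarr_pr pp canon_pr comp1c compc1.
  by rewrite !fcompA jE fcomp1f canonE eE.
Qed.

(** Factoring each [q i] through [lift k y] reduces to vertical arrows; the agreement on overlaps
    survives because an arrow into [pull k y] is determined by its composite with the lift and its
    image in [C]. *)
Lemma stack_glue : arrows_glue.
Proof.
move=> S T k x y c z p q cc pp pq pqE.
have q_sig i : {q' : fhom (z i) (pull k y) |
    pr q' = farr c i /\ lift k y ⊙ q' = q i}.
  apply: constructive_indefinite_description.
  by apply: factor; rewrite pq lift_pr.
have [|i j V t a b ab|w [pw wE]] := @glue_vertical _ _ (pull k y) c z p
  (fun i => proj1_sig (q_sig i)) cc pp.
- by move=> i; case: (proj2_sig (q_sig i)).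
- have [pi qi] := proj2_sig (q_sig i); have [pj qj] := proj2_sig (q_sig j).
  apply: (arrow_inj (u := lift k y)).
    by rewrite !pr_comp pi pj -(pp i) -(pp j) -!pr_comp ab.
  by rewrite !fcompA qi qj; apply: pqE.
- exists (lift k y ⊙ w); split; first by rewrite pr_comp lift_pr pw compc1.
  by move=> i; rewrite -fcompA wE; case: (proj2_sig (q_sig i)).
Qed.

End FromSheaf.

(** The converse of [stack_separated] and [stack_glue], through which the sheaf condition is
    verified for full subcategories of [parts H]. *)
Lemma glue_sheaf : arrows_separated -> arrows_glue ->
  forall S (x y : X S), is_sheaf (isom_full x y).
Proof.
move=> sep gl S x y; split=> // U g c cc s _ sE.
have [|||w [pw wE]] := gl U U (idc U) (pull g x) (pull g y) c _
  (fun i => canon (erefl (g ∘ farr c i)) x)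
  (fun i => canon (erefl (g ∘ farr c i)) y ⊙ iarr (s i)) cc.
- by move=> i; rewrite canon_pr.
- by move=> i; rewrite pr_comp canon_pr iarr_pr compc1 comp1c.
- move=> i j V t a b ab.
  have pab : farr c i ∘ pr a = farr c j ∘ pr b.
    by move/(congr1 pr): ab; rewrite !pr_comp !canon_pr.
  have [k ea] : exists k, g ∘ farr c i ∘ pr a = k by exists (g ∘ farr c i ∘ pr a).
  have eb : g ∘ farr c j ∘ pr b = k by rewrite -ea -!compcA pab.
  (* The matching hypothesis [sE] concerns chosen pullbacks, so the overlap [t] is replaced by the
     isomorphic object [pull k x]. *)
  have [|d dE] := @factor_fiso _ _ _ _ _ (canon ea x) a.
    by rewrite canon_pr.
  have dE' : canon eb x ⊙ iarr d = b.
    apply: (arrow_inj (u := lift _ x)).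
      by rewrite pr_comp canon_pr iarr_pr compc1.
    rewrite fcompA canonE -(canonE (erefl (g ∘ farr c j))) -fcompA -ab fcompA.
    by rewrite canonE -dE fcompA canonE.
  rewrite -{1}dE -dE' -!fcompA.
  rewrite (fcompA (iarr (s i))) (fcompA (iarr (s j))) -!resE.
  rewrite (sE i j _ _ _ _ ea eb pab) !fcompA; congr (_ ⊙ _ ⊙ _).
  apply: (arrow_inj (u := lift g y)); first by rewrite !pr_comp !canon_pr.
  by rewrite !fcompA !canonE.
- have [a aE] := groupoid_fiso grX pw.
  exists a; split.
    split=> // i; apply/esym/res_uniq; by rewrite aE wE.
  move=> b [_ bE]; apply: fiso_eq.
  apply: (sep _ _ _ _ _ _ _ cc); first by rewrite !iarr_pr.
  move=> V z p [i [h ph]].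
  have [|p' [pp' p'E]] := @factor _ _ _ _ _ _ (canon (erefl (g ∘ farr c i)) x) p h.
    by rewrite canon_pr.
  by rewrite -p'E !fcompA aE wE -bE resE.
Qed.

End Arrows.

(** * Subsheaves of automorphisms *)

Section Subsheaves.
Variables (C : site) (X : fibcat C) (grX : fibered_in_groupoids X).

Lemma eq_subset_sym S (x y : X S) (P Q : isom_subset x y) :
  eq_subset P Q -> eq_subset Q P.
Proof. by move=> PQ U g s; apply: iff_sym; apply: PQ. Qed.

Lemma eq_subset_trans S (x y : X S) (Q P R : isom_subset x y) :
  eq_subset P Q -> eq_subset Q R -> eq_subset P R.
Proof. by move=> PQ QR U g s; apply: iff_trans (PQ _ _ _) (QR _ _ _). Qed.

Lemma fiso_conjE S (x y : X S) (d : fiso x y) (s : fiso y y) :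
  iarr d ⊙ iarr (fiso_comp (fiso_inv d) (fiso_comp s d)) = iarr s ⊙ iarr d.
Proof. by rewrite /= fcompA iinvK fcomp1f. Qed.

Lemma mem_along_iso S U (s : X S) (Q : isom_subset s s) (t t' : X U)
  (w : fhom t s) (d : fiso t' t) (g : fiso t t) (g' : fiso t' t') :
  iarr d ⊙ iarr g' = iarr g ⊙ iarr d ->
  mem_along Q (w ⊙ iarr d) g' <-> mem_along Q w g.
Proof.
move=> dg; split=> [] [k [b [u [pu ku ub Qb]]]].
- exists k, b, (u ⊙ iinv d); split=> //.
  + by rewrite pr_comp iinv_pr pu comp1c.
  + by rewrite fcompA ku -fcompA iinvK fcomp1.
  + rewrite fcompA -ub -!fcompA; congr (_ ⊙ _).
    by rewrite -[RHS]fcomp1f -(iarrK d) -!fcompA (fcompA _ (iarr g')) dg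
       -fcompA iinvK fcomp1.
- exists k, b, (u ⊙ iarr d); split=> //.
  + by rewrite pr_comp iarr_pr pu comp1c.
  + by rewrite fcompA ku.
  + by rewrite -fcompA dg !fcompA ub.
Qed.

Lemma mem_along_eq S U (s : X S) (P Q : isom_subset s s) (t : X U)
  (w : fhom t s) (g : fiso t t) :
  eq_subset P Q -> mem_along P w g <-> mem_along Q w g.
Proof.
move=> PQ; split=> [] [k [b [u [pu ku ub Qb]]]]; exists k, b, u; split=> //.
- exact/PQ.
- exact/PQ.
Qed.

Lemma eq_mem_along S (s : X S) (P Q : isom_subset s s) :
  (forall U (t : X U) (w : fhom t s) (g : fiso t t),
    mem_along P w g <-> mem_along Q w g) -> eq_subset P Q.
Proof.
move=> PQ U g t.
by split=> /mem_along_lift H; apply/mem_along_lift; apply/PQ.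
Qed.

Lemma mem_along_res S U V (s : X S) (Q : isom_subset s s) (t : X U) (t' : X V)
  (w : fhom t s) (d : fhom t' t) (g : fiso t t) (g' : fiso t' t') :
  is_sheaf Q -> d ⊙ iarr g' = iarr g ⊙ d ->
  mem_along Q w g -> mem_along Q (w ⊙ d) g'.
Proof.
move=> [Qres _] dg [k [b [u [pu ku ub Qb]]]].
have [l e] : exists l, k ∘ pr d = l by exists (k ∘ pr d).
have [|u' [pu' uE]] := @factor _ _ grX _ _ _ _ _ _ (canon e s) (u ⊙ d) (idc V).
  by rewrite canon_pr pr_comp pu comp1c compc1.
exists l, (res e b), u'; split=> //.
- by rewrite -(canonE e) -fcompA uE fcompA ku.
- apply: (arrow_inj grX (u := canon e s)).
    by rewrite !pr_comp !iarr_pr pu' comp1c.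
  by rewrite !fcompA resE uE -!fcompA uE dg !fcompA ub.
- exact: Qres.
Qed.

(** Conjugation becomes a pullback, so that conjugation and restriction are both governed by
    [pull_subset_comp]. *)
Lemma conj_subsetE S (x y : X S) (a : fiso x y) (P : isom_subset x x) :
  eq_subset (conj_subset a P) (pull_subset (iinv a) P).
Proof.
move=> U g s; rewrite /conj_subset.
apply: iff_trans (iff_sym (pull_subsetE _ _ _)).
apply: iff_trans (iff_sym (mem_along_lift _ _)) _.
have E : lift g x = iinv a ⊙ lift g y ⊙ iarr (pull_fiso g a).
  by rewrite -fcompA base_changeE fcompA iarrK fcomp1f.
rewrite {1}E; apply: mem_along_iso.
exact: fiso_conjE.
Qed.

Lemma pull_subset_iso_inj S T (x : X S) (y : X T) (m : fhom x y) (n : fhom y x)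
  (P Q : isom_subset y y) : m ⊙ n = fid y ->
  eq_subset (pull_subset m P) (pull_subset m Q) -> eq_subset P Q.
Proof.
move=> mn PQ; have PE (R : isom_subset y y) :
    eq_subset R (pull_subset n (pull_subset m R)).
  move=> U g s; apply: iff_trans (pull_subset_id R s) _.
  by rewrite -mn; apply: iff_sym; exact: (pull_subset_comp grX).
move=> U g s; apply: iff_trans (PE _ _ _ _) _.
apply: iff_trans (iff_sym (PE _ _ _ _)); exact: eq_pull_subset.
Qed.

Hypothesis sepX : arrows_separated X.

(** After transport to a chosen pullback of [s], the restrictions of [g] along the sieve glue to a
    member of the sheaf [Q], and separatedness identifies that member with [g]. *)
Lemma mem_along_local S U (s : X S) (Q : isom_subset s s) (t : X U)
  (w : fhom t s) (g : fiso t t) (R : sieve U) :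
  is_sheaf Q -> covers R ->
  (forall V (t' : X V) (d : fhom t' t) (g' : fiso t' t'), R V (pr d) ->
    d ⊙ iarr g' = iarr g ⊙ d -> mem_along Q (w ⊙ d) g') ->
  mem_along Q w g.
Proof.
move=> shQ cR locQ; have [k ek] : exists k, pr w = k by exists (pr w).
have [|d dE] := @factor_fiso _ _ grX _ _ _ _ _ w (lift k s).
  by rewrite lift_pr.
have [g1 dg] : exists g1 : Isom s s k, iarr d ⊙ iarr g1 = iarr g ⊙ iarr d.
  by exists (fiso_comp (fiso_inv d) (fiso_comp g d)); apply: fiso_conjE.
apply/(mem_along_iso Q w dg); rewrite dE; apply/mem_along_lift.
have [_ gl] := shQ.
have gi i : Q _ _ (res (erefl (k ∘ farr (sieve_family R) i)) g1).
  apply/mem_along_lift; rewrite -(canonE erefl) -dE -fcompA.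
  apply: locQ.
    by rewrite pr_comp iarr_pr canon_pr comp1c; apply: (proj2_sig (projT2 i)).
  by rewrite -fcompA resE !fcompA dg.
have [i j V a b l ea eb ab|r [[Qr rE] _]] :=
    gl U k _ (sieve_family_cover cR) _ gi.
  have ea' : k ∘ (farr (sieve_family R) i ∘ a) = l by rewrite compcA.
  have eb' : k ∘ (farr (sieve_family R) j ∘ b) = l by rewrite compcA.
  rewrite (res_res grX _ _ ea') (res_res grX _ _ eb').
  by move: ab ea' eb' => -> ea' eb'; congr res; apply: proof_irrelevance.
suff -> : g1 = r by [].
apply: fiso_eq; apply: (sepX cR); first by rewrite !iarr_pr.
move=> V z p Rp.
pose i : fidx (sieve_family R) := existT _ V (exist _ (pr p) Rp).
have [|e eE] := @factor_fiso _ _ grX _ _ _ _ _ (canon (erefl (k ∘ farr _ i)) s) p.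
  by rewrite canon_pr.
by rewrite -eE !fcompA -!resE (rE i).
Qed.

Lemma subsheaf_of_local S (s : X S) (Q : isom_subset s s) :
  is_sheaf (isom_full s s) ->
  (forall U V (g : hom U S) (a : hom V U) (k : hom V S) (e : g ∘ a = k)
     (t : Isom s s g), Q U g t -> Q V k (res e t)) ->
  (forall U (g : hom U S) (c : family U) (t : Isom s s g), is_cover c ->
     (forall i, Q _ _ (res (erefl (g ∘ farr c i)) t)) -> Q U g t) ->
  is_sheaf Q.
Proof.
move=> [_ gl] Qres Qloc; split=> // U g c cc s0 Qs0 s0E.
have [|t [[_ tE] tU]] := gl U g c cc s0 _ s0E; first by [].
exists t; split; first by split=> //; apply: (Qloc _ _ _ _ cc) => i; rewrite tE.
by move=> t' [_ t'E]; apply: tU; split.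
Qed.

Lemma eq_subset_local S (s : X S) (P Q : isom_subset s s) (c : family S)
  (z : forall i, X (fdom c i)) (p : forall i, fhom (z i) s) :
  is_sheaf P -> is_sheaf Q -> is_cover c -> (forall i, pr (p i) = farr c i) ->
  (forall i, eq_subset (pull_subset (p i) P) (pull_subset (p i) Q)) ->
  eq_subset P Q.
Proof.
have half P' Q' : is_sheaf P' -> is_sheaf Q' -> is_cover c ->
    (forall i, pr (p i) = farr c i) ->
    (forall i, eq_subset (pull_subset (p i) P') (pull_subset (p i) Q')) ->
    forall U (t : X U) (w : fhom t s) (g : fiso t t),
    mem_along P' w g -> mem_along Q' w g.
  move=> shP shQ cc pp PQ U t w g Pg.
  apply: (mem_along_local shQ (covers_pull (pr w) cc)) => V t' d g' [i [h ph]] dg.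
  have [|e [pe eE]] := @factor _ _ grX _ _ _ _ _ _ (p i) (w ⊙ d) h.
    by rewrite pr_comp pp.
  rewrite -eE; apply/(mem_along_pull grX)/(mem_along_eq _ _ (PQ i)).
  apply/(mem_along_pull grX); rewrite eE; exact: mem_along_res dg Pg.
move=> shP shQ cc pp PQ; apply: eq_mem_along => U t w g; split; apply: half => //.
by move=> i; apply/eq_subset_sym/PQ.
Qed.

End Subsheaves.

(** * Descent for objects *)

Section Descent.
Variables (C : site) (X : fibcat C) (grX : fibered_in_groupoids X).
Variables (S : C) (c : family S) (z : forall i, X (fdom c i)).

(* A descent datum without chosen pullbacks: [E i j V t a b] says that the
   [V]-points [a] of [z i] and [b] of [z j] are to be identified. *)
Variable E : forall i j V (t : X V), fhom t (z i) -> fhom t (z j) -> Prop.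
Hypothesis E_pr : forall i j V (t : X V) (a : fhom t (z i)) (b : fhom t (z j)),
  E a b -> farr c i ∘ pr a = farr c j ∘ pr b.
Hypothesis E_res : forall i j V W (t : X V) (t' : X W) (a : fhom t (z i))
  (b : fhom t (z j)) (u : fhom t' t), E a b -> E (a ⊙ u) (b ⊙ u).
Hypothesis E_total : forall i j V (t : X V) (a : fhom t (z i))
  (g : hom V (fdom c j)), farr c i ∘ pr a = farr c j ∘ g ->
  exists b : fhom t (z j), pr b = g /\ E a b.
Hypothesis E_uniq : forall i j V (t : X V) (a : fhom t (z i))
  (b b' : fhom t (z j)), E a b -> E a b' -> pr b = pr b' -> b = b'.
Hypothesis E_trans : forall i j k V (t : X V) (a : fhom t (z i))
  (b : fhom t (z j)) (d : fhom t (z k)), E a b -> E b d -> E a d.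

(** The gluing isomorphism over [a], [b] is read off the point of [z j] over [b] that [E] relates to
    [lift a (z i)]. Its uniqueness, from [E_uniq], yields both the compatibility with restriction
    and the cocycle condition. *)
Lemma rel_iso_sig i j V (a : hom V (fdom c i)) (b : hom V (fdom c j)) :
  farr c i ∘ a = farr c j ∘ b ->
  {d : fiso (pull a (z i)) (pull b (z j)) |
    E (lift a (z i)) (lift b (z j) ⊙ iarr d)}.
Proof.
move=> e; apply: constructive_indefinite_description.
have [|b0 [pb0 Eb0]] := @E_total i j _ _ (lift a (z i)) b.
  by rewrite lift_pr.
have [|d dE] := @factor_fiso _ _ grX _ _ _ _ _ (lift b (z j)) b0.
  by rewrite lift_pr.
by exists d; rewrite dE.
Qed.

Definition rel_iso i j V (a : hom V (fdom c i)) (b : hom V (fdom c j))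
  (e : farr c i ∘ a = farr c j ∘ b) : fiso (pull a (z i)) (pull b (z j)) :=
  proj1_sig (rel_iso_sig e).

Lemma rel_isoP i j V (a : hom V (fdom c i)) (b : hom V (fdom c j))
  (e : farr c i ∘ a = farr c j ∘ b) :
  E (lift a (z i)) (lift b (z j) ⊙ iarr (rel_iso e)).
Proof. exact: (proj2_sig (rel_iso_sig e)). Qed.

Lemma rel_iso_uniq i j V (a : hom V (fdom c i)) (b : hom V (fdom c j))
  (e : farr c i ∘ a = farr c j ∘ b) (d : fiso (pull a (z i)) (pull b (z j))) :
  E (lift a (z i)) (lift b (z j) ⊙ iarr d) -> rel_iso e = d.
Proof.
move=> Ed; apply: (fiso_lift_eq grX); apply: (E_uniq (rel_isoP e) Ed).
by rewrite !pr_comp !iarr_pr.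
Qed.

Definition rel_datum : descent_datum X c.
Proof.
apply: (@DescentDatum C X S c z rel_iso).
- move=> i j V W a b h e e'; apply: rel_iso_uniq.
  rewrite -(canonE erefl) -[lift (b ∘ h) _](canonE erefl) -fcompA base_changeE.
  by rewrite fcompA; apply/E_res/rel_isoP.
- move=> i j k V a b d eab ebd ead; apply/esym/rel_iso_uniq.
  apply: (E_trans (rel_isoP eab)) => /=; rewrite fcompA.
  exact/E_res/rel_isoP.
Defined.

Lemma descend : (forall D : descent_datum X c, effective D) ->
  exists (x : X S) (p : forall i, fhom (z i) x),
    (forall i, pr (p i) = farr c i) /\
    forall i j V (t : X V) (a : fhom t (z i)) (b : fhom t (z j)),
      E a b <-> p i ⊙ a = p j ⊙ b.
Proof.
move/(_ rel_datum)=> [x [p [pp pE]]]; exists x, p; split=> [i|]; first by case: (pp i).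
have half i j V (t : X V) (a : fhom t (z i)) (b : fhom t (z j)) :
    E a b -> p i ⊙ a = p j ⊙ b.
  move=> Eab; have e := E_pr Eab.
  have [|d dE] := @factor_fiso _ _ grX _ _ _ _ _ (lift (pr a) (z i)) a.
    by rewrite lift_pr.
  have -> : b = lift (pr b) (z j) ⊙ iarr (rel_iso e) ⊙ iarr d.
    apply: (E_uniq Eab); last by rewrite !pr_comp lift_pr !iarr_pr !compc1.
    by rewrite -{1}dE; apply/E_res/rel_isoP.
  by rewrite -{1}dE !fcompA -(pE i j V _ _ e).
move=> i j V t a b; split=> [/half //|ab].
(* The glued object identifies no pair outside [E]: the point [b'] over [pr b] related to [a] has
   the same composite with [p j] as [b]. *)
have [|b' [pb' Eb']] := @E_total i j _ _ a (pr b).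
  case: (pp i) (pp j) => <- _ [<- _].
  by move/(congr1 pr): ab; rewrite !pr_comp.
suff -> : b = b' by [].
by apply: (arrow_inj grX (u := p j)); rewrite ?pb' // -ab; apply: half.
Qed.

End Descent.

(** * Descent data along a functor *)

Section PushDescent.
Variables (C : site) (X Y : fibcat C) (F : fibmor X Y).
Hypothesis (grY : fibered_in_groupoids Y).
Hypothesis effY : forall S (c : family S), is_cover c ->
  forall D : descent_datum Y c, effective D.

(** As [F] need not preserve chosen pullbacks, the image of [D] is formed as a relation: two points
    are identified when both come from one point [d] of the image of a pullback, the second through
    the isomorphism of [D]. The last clause recovers overlaps in [Y] from overlaps in [X]. *)
Lemma push_descent S (c : family S) (D : descent_datum X c) :
  is_cover c ->
  exists (y : Y S) (p : forall i, fhom (mob F (descent_ob D i)) y),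
  [/\ forall i, pr (p i) = farr c i,
      forall i j V (a : hom V (fdom c i)) (b : hom V (fdom c j))
        (e : farr c i ∘ a = farr c j ∘ b),
        p j ⊙ mhom F (lift b (descent_ob D j) ⊙ iarr (descent_iso D e)) =
        p i ⊙ mhom F (lift a (descent_ob D i)) &
      forall i j V (t : Y V) (a : fhom t (mob F (descent_ob D i)))
        (b : fhom t (mob F (descent_ob D j))), p i ⊙ a = p j ⊙ b ->
        exists (g : hom V (fdom c i)) (h : hom V (fdom c j))
          (e : farr c i ∘ g = farr c j ∘ h)
          (d : fhom t (mob F (pull g (descent_ob D i)))),
          [/\ pr d = idc V, mhom F (lift g _) ⊙ d = a &
              mhom F (lift h _ ⊙ iarr (descent_iso D e)) ⊙ d = b]].
Proof.
move=> cc; pose z i := mob F (descent_ob D i).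
pose E i j V (t : Y V) (a : fhom t (z i)) (b : fhom t (z j)) :=
  exists (g : hom V (fdom c i)) (h : hom V (fdom c j))
    (e : farr c i ∘ g = farr c j ∘ h)
    (d : fhom t (mob F (pull g (descent_ob D i)))),
    [/\ pr d = idc V, mhom F (lift g _) ⊙ d = a &
        mhom F (lift h _ ⊙ iarr (descent_iso D e)) ⊙ d = b].
have Epr i j V (t : Y V) (a : fhom t (z i)) (b : fhom t (z j)) : E _ _ _ _ a b ->
    farr c i ∘ pr a = farr c j ∘ pr b.
  case=> g [h [e [d [pd <- <-]]]].
  by rewrite !pr_comp !mhom_pr pr_comp iarr_pr pd !lift_pr !compc1.
have Eres i j V W (t : Y V) (t' : Y W) (a : fhom t (z i)) (b : fhom t (z j))
    (u : fhom t' t) : E _ _ _ _ a b -> E _ _ _ _ (a ⊙ u) (b ⊙ u).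
  case=> g [h [e [d [pd dE <-]]]].
  have e' : farr c i ∘ (g ∘ pr u) = farr c j ∘ (h ∘ pr u).
    by rewrite !compcA e.
  have [|d' [pd' d'E]] := @factor _ _ grY _ _ _ _ _ _
      (mhom F (canon (erefl (g ∘ pr u)) (descent_ob D i))) (d ⊙ u) (idc W).
    by rewrite mhom_pr canon_pr pr_comp pd comp1c compc1.
  exists (g ∘ pr u), (h ∘ pr u), e', d'; split=> //.
  - by rewrite -(canonE erefl) mhom_comp -fcompA d'E fcompA dE.
  - rewrite (descent_res D e e') -{1}(canonE erefl) -fcompA base_changeE.
    by rewrite fcompA mhom_comp -fcompA d'E fcompA.
have Etot i j V (t : Y V) (a : fhom t (z i)) (h : hom V (fdom c j)) :
    farr c i ∘ pr a = farr c j ∘ h -> exists b, pr b = h /\ E i j _ _ a b.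
  move=> e.
  have [|d dE] := @factor_fiso _ _ grY _ _ _ _ _ (mhom F (lift (pr a) (descent_ob D i))) a.
    by rewrite mhom_pr lift_pr.
  exists (mhom F (lift h _ ⊙ iarr (descent_iso D e)) ⊙ iarr d); split.
    by rewrite pr_comp mhom_pr pr_comp lift_pr !iarr_pr !compc1.
  by exists (pr a), h, e, (iarr d); split=> //; apply: iarr_pr.
have Euniq i j V (t : Y V) (a : fhom t (z i)) (b b' : fhom t (z j)) :
    E _ _ _ _ a b -> E _ _ _ _ a b' -> pr b = pr b' -> b = b'.
  case=> g [h [e [d [pd dE <-]]]] [g' [h' [e' [d' [pd' d'E <-]]]]].
  rewrite !pr_comp !mhom_pr !pr_comp !iarr_pr !lift_pr pd pd' !compc1 => hh'.
  have gg' : g = g'.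
    move: (congr1 pr dE) (congr1 pr d'E).
    by rewrite !pr_comp !mhom_pr !lift_pr pd pd' !compc1 => -> ->.
  move: gg' hh' e' d' pd' d'E => <- <- e' d' pd' d'E.
  rewrite (proof_irrelevance _ e e'); congr (_ ⊙ _).
  by apply: (arrow_inj grY (u := mhom F (lift g _))); rewrite ?pd ?pd' ?dE.
have Etrans i j k V (t : Y V) (a : fhom t (z i)) (b : fhom t (z j))
    (d : fhom t (z k)) : E _ _ _ _ a b -> E _ _ _ _ b d -> E _ _ _ _ a d.
  case=> g [h [e [u [pu uE <-]]]] [h' [l [e' [v [pv vE <-]]]]].
  have hh' : h' = h.
    move/(congr1 pr): vE.
    by rewrite !pr_comp !mhom_pr !pr_comp iarr_pr !lift_pr pu pv !compc1.
  move: hh' e' v pv vE => -> e' v pv vE.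
  have e'' : farr c i ∘ g = farr c k ∘ l by rewrite e.
  exists g, l, e'', u; split=> //.
  have -> : v = mhom F (iarr (descent_iso D e)) ⊙ u.
    apply: (arrow_inj grY (u := mhom F (lift h _))).
      by rewrite pv pr_comp mhom_pr iarr_pr pu compc1.
    by rewrite vE mhom_comp fcompA.
  by rewrite -(descent_cocycle D e e' e'') /= fcompA !mhom_comp !fcompA.
have [y [p [pp pE]]] := descend grY Epr Eres Etot Euniq Etrans (effY cc).
exists y, p; split=> //; last by move=> i j V t a b /pE.
move=> i j V a b e; apply/esym/pE.
exists a, b, e, (fid _); by rewrite pr_id !fcomp1.
Qed.

End PushDescent.

Section FaithfulDescent.
Variables (C : site) (X Y : fibcat C) (F : fibmor X Y).
Hypotheses (stX : stack_in_groupoids X) (stY : stack_in_groupoids Y).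
Hypothesis faithF : faithful F.

(** Points of the [z i] are related when their images agree in [y]. The overlap hypothesis makes
    related points exist and faithfulness makes them unique, so the pieces glue to some [x]; its
    image and [y] are then glued from the same pieces. *)
Lemma faithful_descent S (c : family S) (y : Y S)
  (z : forall i, X (fdom c i)) (p : forall i, fhom (mob F (z i)) y) :
  is_cover c -> (forall i, pr (p i) = farr c i) ->
  (forall i j V (a : hom V (fdom c i)) (b : hom V (fdom c j)),
    farr c i ∘ a = farr c j ∘ b ->
    exists (t : X V) (d : fhom t (z i)) (e : fhom t (z j)),
      [/\ pr d = a, pr e = b & p i ⊙ mhom F d = p j ⊙ mhom F e]) ->
  exists (x : X S) (b : fiso (mob F x) y) (q : forall i, fhom (z i) x),
    forall i, iarr b ⊙ mhom F (q i) = p i.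
Proof.
move=> cc pp ov; have [grX _ effX] := stX; have [grY shY _] := stY.
pose E i j V (t : X V) (a : fhom t (z i)) (b : fhom t (z j)) :=
  p i ⊙ mhom F a = p j ⊙ mhom F b.
have Epr i j V (t : X V) (a : fhom t (z i)) (b : fhom t (z j)) : E _ _ _ _ a b ->
    farr c i ∘ pr a = farr c j ∘ pr b.
  by move/(congr1 pr); rewrite !pr_comp !mhom_pr !pp.
have Eres i j V W (t : X V) (t' : X W) (a : fhom t (z i)) (b : fhom t (z j))
    (u : fhom t' t) : E _ _ _ _ a b -> E _ _ _ _ (a ⊙ u) (b ⊙ u).
  by rewrite /E !mhom_comp !fcompA => ->.
have Etot i j V (t : X V) (a : fhom t (z i)) (h : hom V (fdom c j)) :
    farr c i ∘ pr a = farr c j ∘ h -> exists b, pr b = h /\ E i j _ _ a b.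
  case/ov => t' [d [e [pd pe de]]].
  have [|u uE] := @factor_fiso _ _ grX _ _ _ _ _ d a; first by rewrite pd.
  exists (e ⊙ iarr u); split; first by rewrite pr_comp iarr_pr compc1.
  by rewrite -uE; apply: Eres.
have Euniq i j V (t : X V) (a : fhom t (z i)) (b b' : fhom t (z j)) :
    E _ _ _ _ a b -> E _ _ _ _ a b' -> pr b = pr b' -> b = b'.
  move=> Eb Eb' bb'; apply: faithF; apply: (arrow_inj grY (u := p j)).
    by rewrite !mhom_pr.
  by rewrite -Eb -Eb'.
have Etrans i j k V (t : X V) (a : fhom t (z i)) (b : fhom t (z j))
    (d : fhom t (z k)) : E _ _ _ _ a b -> E _ _ _ _ b d -> E _ _ _ _ a d.
  by rewrite /E => ->.
have [x [q [pq qE]]] := descend grX Epr Eres Etot Euniq Etrans (effX _ _ cc).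
have [||i j V t a b|w [pw wE]] := stack_glue grY shY (k := idc S)
  (p := fun i => mhom F (q i)) (q := p) cc.
- by move=> i; rewrite mhom_pr.
- by move=> i; rewrite comp1c.
- move=> ab.
  (* Agreement is required on overlaps in [Y]; each is isomorphic to the image of an overlap in
     [X]. *)
  have [|t' [d [e [pd pe de]]]] := ov i j V (pr a) (pr b).
    by rewrite -!pq; move/(congr1 pr): ab; rewrite !pr_comp !mhom_pr.
  have [|u uE] := @factor_fiso _ _ grY _ _ _ _ _ (mhom F d) a.
    by rewrite mhom_pr pd.
  suff -> : b = mhom F e ⊙ iarr u by rewrite -uE !fcompA de.
  apply: (arrow_inj grY (u := mhom F (q j))).
    by rewrite pr_comp mhom_pr pe iarr_pr compc1.
  rewrite -ab -uE !fcompA -!mhom_comp.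
  by move/qE: de => ->.
- have [b bE] := groupoid_fiso grY pw.
  by exists x, b, q => i; rewrite bE.
Qed.

End FaithfulDescent.

(** * The stack of parts of the inertia *)

(** Up to an isomorphism of its source, every arrow into [mob F x] is the image of an arrow into
    [x]. *)
Lemma faithful_separated (C : site) (X Y : fibcat C) (F : fibmor X Y) :
  fibered_in_groupoids Y -> faithful F ->
  arrows_separated Y -> arrows_separated X.
Proof.
move=> grY faithF sepY S T x y R w w' cR pw ww'; apply: faithF.
apply: (sepY _ _ _ _ _ _ _ cR); first by rewrite !mhom_pr.
move=> V z p Rp.
have [|d <-] := @factor_fiso _ _ grY _ _ _ _ _ (mhom F (lift (pr p) x)) p.
  by rewrite mhom_pr lift_pr.
rewrite !fcompA -!mhom_comp ww' // lift_pr //.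
Qed.

Section FullSubcategory.
Variables (C : category) (X : fibcat C).
Hypothesis cartX : forall S T (x : X S) (y : X T) (u : fhom x y), cartesian u.
Variable K : forall S, X S -> Prop.
Hypothesis K_pull : forall S T (x : X S) (y : X T), fhom x y -> K y -> K x.

Definition full_over : overcat C.
Proof.
apply: (@OverCat C (fun S => {x : X S | K x})
  (fun S T x y => fhom (proj1_sig x) (proj1_sig y)) (fun _ _ _ _ u => pr u)
  (fun _ _ => fid _) (fun _ _ _ _ _ _ v u => v ⊙ u)).
- by move=> *; apply: pr_id.
- by move=> *; apply: pr_comp.
- by move=> *; apply: fcomp1.
- by move=> *; apply: fcomp1f.
- by move=> *; apply: fcompA.
Defined.

Lemma full_cart S T (x : full_over S) (y : full_over T) (u : fhom x y) :
  cartesian u.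
Proof. by move=> R z; apply: cartX. Qed.

Lemma full_lift S T (f : hom S T) (y : full_over T) :
  exists (x : full_over S) (u : fhom x y), pr u = f /\ cartesian u.
Proof.
have Kx : K (pull f (proj1_sig y)) := K_pull (lift f _) (proj2_sig y).
exists (exist _ _ Kx), (lift f (proj1_sig y)); split; first exact: lift_pr.
exact: full_cart.
Qed.

Definition full_sub : fibcat C := FibCat full_lift.

Definition full_incl : fibmor full_sub X.
Proof.
by apply: (@FibMor C full_sub X (fun _ x => proj1_sig x) (fun _ _ _ _ u => u)) => //.
Defined.

Definition full_fiso S (x y : full_sub S)
  (a : fiso (proj1_sig x) (proj1_sig y)) : fiso x y :=
  @FIso C full_sub S x y (iarr a) (iinv a) (iarr_pr a) (iinv_pr a)
    (iarrK a) (iinvK a).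

Definition full_lift_mor (Y : fibcat C) (F : fibmor Y X)
  (KF : forall S (y : Y S), K (mob F y)) : fibmor Y full_sub.
Proof.
apply: (@FibMor C Y full_sub (fun S y => exist _ (mob F y) (KF S y))
  (fun _ _ _ _ u => mhom F u)).
- by move=> *; apply: mhom_pr.
- by move=> *; apply: mhom_id.
- by move=> *; apply: mhom_comp.
- by move=> *; apply: full_cart.
Defined.

End FullSubcategory.

Lemma full_groupoids (C : site) (X : fibcat C) cartX
  (K : forall S, X S -> Prop) K_pull :
  fibered_in_groupoids X ->
  fibered_in_groupoids (@full_sub C X cartX K K_pull).
Proof.
move=> grX S x y u pu; have [a aE] := grX _ _ _ _ pu.
by exists (full_fiso a).
Qed.

Lemma full_glue (C : site) (X : fibcat C) cartX
  (K : forall S, X S -> Prop) K_pull :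
  arrows_glue X -> arrows_glue (@full_sub C X cartX K K_pull).
Proof.
move=> gl S T k x y c z p q cc pp pq pqE.
apply: (gl _ _ k (proj1_sig x) (proj1_sig y) c (fun i => proj1_sig (z i))) => //.
move=> i j V t a b ab.
(* The overlap [t] satisfies [K] because [a] maps it to [z i]. *)
exact: (pqE i j V (exist _ t (K_pull _ _ _ _ a (proj2_sig (z i)))) a b).
Qed.

Section PartsStack.
Variables (C : site) (H : gerbe C).

Lemma gerbe_groupoids : fibered_in_groupoids H.
Proof. by case: (gerbe_stack H). Qed.
Let grH := gerbe_groupoids.

Lemma gerbe_isom_sheaf S (x y : H S) : is_sheaf (isom_full x y).
Proof. by case: (gerbe_stack H). Qed.

Lemma gerbe_separated : arrows_separated H.
Proof. exact: (stack_separated grH gerbe_isom_sheaf). Qed.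

Lemma gerbe_glue : arrows_glue H.
Proof. exact: (stack_glue grH gerbe_isom_sheaf). Qed.

Lemma parts_mem S T (x : parts H S) (y : parts H T) (u : fhom x y) U
  (t : H U) (w : fhom t (parts_base x)) (g : fiso t t) :
  mem_along (parts_sub y) (parts_arr u ⊙ w) g <-> mem_along (parts_sub x) w g.
Proof.
apply: iff_trans (iff_sym (mem_along_pull grH _ _ _ _)) _.
by apply: iff_sym; apply: mem_along_eq (parts_arrP u).
Qed.

Lemma parts_groupoids : fibered_in_groupoids (parts H).
Proof.
move=> S x y u pu; have [a aE] := groupoid_fiso grH pu.
have inv : eq_subset (parts_sub y) (pull_subset (iinv a) (parts_sub x)).
  apply: eq_mem_along => U t w g.
  apply: iff_trans (iff_sym (mem_along_pull grH _ _ _ _)).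
  apply: iff_trans (parts_mem u _ _).
  by rewrite fcompA -aE iinvK fcomp1f.
pose v : @fhom _ (parts H) _ _ y x := PartsHom inv.
have vu : v ⊙ u = fid x by apply: parts_hom_eq; rewrite /= -aE iarrK.
have uv : u ⊙ v = fid y by apply: parts_hom_eq; rewrite /= -aE iinvK.
by exists (@FIso _ (parts H) S x y u v pu (iinv_pr a) vu uv).
Qed.

Lemma parts_forget_faithful : faithful (parts_forget H).
Proof. move=> S T x y u v; exact: parts_hom_eq. Qed.

Lemma parts_glue : arrows_glue (parts H).
Proof.
move=> S T k x y c z p q cc pp pq pqE.
have [i j V t a b ab|w [pw wE]] := gerbe_glue (k := k)
  (p := fun i => parts_arr (p i)) (q := fun i => parts_arr (q i)) cc pp pq.
  (* An overlap [t] in [H] becomes one in [parts H] once it carries the subsheaf pulled back along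
     [a]; then [b] respects subsheaves too, being the factor of [p i ⊙ a'] through [p j]. *)
  pose t' := PartsOb (AutSubsheaf
    (pull_subset_sheaf grH a (sub_sheaf (parts_sub (z i))))).
  pose a' : @fhom _ (parts H) _ _ t' (z i) :=
    @PartsHom _ _ _ _ t' (z i) a (fun _ _ _ => iff_refl _).
  have [|b' [pb' bE']] := @factor _ _ parts_groupoids _ _ _ _ _ _ (p j)
    (p i ⊙ a') (pr b).
    exact: etrans (congr1 pr ab) (pr_comp _ _).
  have bE : parts_arr b' = b.
    apply: (arrow_inj grH (u := parts_arr (p j))); first exact: pb'.
    by rewrite -ab; apply: (congr1 (@parts_arr _ _ _ _ _ _) bE').
  have := congr1 (@parts_arr _ _ _ _ _ _) (pqE _ _ _ _ _ _ (esym bE')).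
  by rewrite /= bE.
have Hw : eq_subset (parts_sub x) (pull_subset w (parts_sub y)).
  apply: (eq_subset_local grH gerbe_separated (p := fun i => parts_arr (p i))
    _ _ cc pp).
  - exact: sub_sheaf.
  - exact/(pull_subset_sheaf grH)/sub_sheaf.
  move=> i; apply: eq_subset_trans (eq_subset_sym (parts_arrP (p i))) _.
  apply: eq_subset_trans (parts_arrP (q i)) _; rewrite -wE.
  exact/eq_subset_sym/(pull_subset_comp grH).
exists (PartsHom Hw); split=> // i; exact: parts_hom_eq.
Qed.

End PartsStack.

(** * Gluing subsheaves, and descent in full subcategories of the parts *)

Section GlueSubsheaves.
Variables (C : site) (H : gerbe C) (S : C) (c : family S).
Variables (y : H S) (z : forall i, parts H (fdom c i))
  (p : forall i, fhom (parts_base (z i)) y).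
Hypothesis z_agree : forall i j V (t : H V) (a : fhom t (parts_base (z i)))
  (b : fhom t (parts_base (z j))) (g : fiso t t), p i ⊙ a = p j ⊙ b ->
  mem_along (parts_sub (z i)) a g -> mem_along (parts_sub (z j)) b g.
Let grH := @gerbe_groupoids C H.

(** Every restriction of [s] that can be seen on some [z i] must lie in the subsheaf there.
    Quantifying over all of them makes stability under restriction immediate and reduces locality to
    that of the given subsheaves. *)
Definition glued_subset : isom_subset y y := fun U g s =>
  forall i V (t : H V) (a : fhom t (parts_base (z i))) (d : fhom t (pull g y))
    (r : fiso t t), p i ⊙ a = lift g y ⊙ d -> d ⊙ iarr r = iarr s ⊙ d ->
  mem_along (parts_sub (z i)) a r.

Lemma glued_sheaf : is_sheaf glued_subset.
Proof.
apply: subsheaf_of_local; first exact: gerbe_isom_sheaf.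
  move=> U V g a k e s Qs i W t b d r bd dr.
  apply: (Qs _ _ _ b (canon e y ⊙ d)); first by rewrite fcompA canonE.
  by rewrite -fcompA dr !fcompA resE.
move=> U g c' s cc' Qs i V t a d r ad dr.
apply: (mem_along_local grH (gerbe_separated (H := H)) (sub_sheaf _)
  (covers_pull (pr d) cc')) => W t' e r' [j [h pe]] er.
have [|d' [pd' d'E]] := @factor _ _ grH _ _ _ _ _ _
    (canon (erefl (g ∘ farr c' j)) y) (d ⊙ e) h.
  by rewrite canon_pr pr_comp.
apply: (Qs j _ _ _ _ d').
  by rewrite -(canonE erefl) -fcompA d'E !fcompA ad.
apply: (arrow_inj grH (u := canon (erefl (g ∘ farr c' j)) y)).
  by rewrite !pr_comp !iarr_pr compc1 comp1c.
by rewrite [RHS]fcompA resE -[RHS]fcompA fcompA d'E -fcompA er fcompA dr !fcompA.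
Qed.

Lemma glued_mem U (t : H U) (w : fhom t y) (g : fiso t t) :
  mem_along glued_subset w g <->
  forall i V (t' : H V) (a : fhom t' (parts_base (z i))) (e : fhom t' t)
    (r : fiso t' t'), p i ⊙ a = w ⊙ e -> e ⊙ iarr r = iarr g ⊙ e ->
  mem_along (parts_sub (z i)) a r.
Proof.
have [k ek] : exists k, pr w = k by exists (pr w).
have [|d dE] := @factor_fiso _ _ grH _ _ _ _ _ w (lift k y).
  by rewrite lift_pr.
have [s ds] : exists s : Isom y y k, iarr d ⊙ iarr s = iarr g ⊙ iarr d.
  by exists (fiso_comp (fiso_inv d) (fiso_comp g d)); apply: fiso_conjE.
apply: iff_trans (iff_sym (mem_along_iso _ _ ds)) _; rewrite dE.
apply: iff_trans (mem_along_lift _ _) _; split=> Qs i V t' a e r ae er.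
  apply: (Qs _ _ _ _ (iinv d ⊙ e)).
    by rewrite -dE ae !fcompA -(fcompA w) iinvK fcomp1.
  rewrite -fcompA er !fcompA; congr (_ ⊙ _).
  rewrite -[iinv d ⊙ iarr g]fcomp1 -(iinvK d) !fcompA -(fcompA (iinv d)) -ds.
  by rewrite fcompA iarrK fcomp1f.
apply: (Qs _ _ _ _ (iarr d ⊙ e)); first by rewrite ae -dE fcompA.
by rewrite -fcompA er !fcompA ds.
Qed.

(** By [z_agree], a member of the subsheaf of [z i] passes the test on every [z j]; conversely, the
    test on [z i] itself along the identity gives membership. *)
Lemma glued_pull i :
  eq_subset (parts_sub (z i)) (pull_subset (p i) glued_subset).
Proof.
move=> U g s; apply: iff_trans (iff_sym (pull_subsetE _ _ _)).
apply: iff_trans (iff_sym (glued_mem _ _)).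
split=> [/mem_along_lift Ps j V t' a e r ae er|].
  apply: (z_agree (i := i) (a := lift g _ ⊙ e)); first by rewrite ae fcompA.
  exact: (mem_along_res grH (sub_sheaf _) er).
move=> Qs; apply/mem_along_lift.
by apply: (Qs _ _ _ _ (fid _)); rewrite ?fcomp1 ?fcomp1f.
Qed.

End GlueSubsheaves.

Section FullParts.
Variables (C : site) (H : gerbe C).
Variable K : forall S, parts H S -> Prop.
Hypothesis K_pull : forall S T (x : parts H S) (y : parts H T),
  fhom x y -> K y -> K x.
Hypothesis K_local : forall S (x : parts H S) (c : family S)
  (z : forall i, parts H (fdom c i)) (p : forall i, fhom (z i) x),
  is_cover c -> (forall i, pr (p i) = farr c i) -> (forall i, K (z i)) -> K x.
Let grH := @gerbe_groupoids C H.

Definition full_parts : fibcat C :=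
  @full_sub C (parts H) (@parts_cart C H) K K_pull.

Definition full_forget : fibmor full_parts H :=
  fibmor_comp (parts_forget H) (full_incl _ _).

Lemma full_forget_faithful : faithful full_forget.
Proof. move=> S T x y u v; exact: parts_hom_eq. Qed.

Lemma full_parts_groupoids : fibered_in_groupoids full_parts.
Proof. exact/full_groupoids/parts_groupoids. Qed.

(** The base object is descended in [H]. Overlaps in [H] come from overlaps in [full_parts] by the
    last clause of [push_descent], and there the gluing isomorphisms respect subsheaves; so the
    subsheaves agree and glue. [K_local] keeps the result in the subcategory. *)
Lemma full_parts_effective S (c : family S) : is_cover c ->
  forall D : descent_datum full_parts c, effective D.
Proof.
move=> cc D; have [_ _ effH] := gerbe_stack H.
have [y [p [pp pD pE]]] := push_descent full_forget grH effH D cc.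
pose z i : parts H (fdom c i) := proj1_sig (descent_ob D i).
have agree i j V (t : H V) (a : fhom t (parts_base (z i)))
    (b : fhom t (parts_base (z j))) (g : fiso t t) : p i ⊙ a = p j ⊙ b ->
    mem_along (parts_sub (z i)) a g -> mem_along (parts_sub (z j)) b g.
  case/pE => [h [l [e [d [pd <- <-]]]]] /= Pa.
  apply/(parts_mem (lift l (descent_ob D j) ⊙ iarr (descent_iso D e) :
    @fhom _ (parts H) _ _ (proj1_sig (pull h (descent_ob D i))) (z j))).
  by apply/(parts_mem (y := z i) (lift h (descent_ob D i))).
pose x : parts H S := @PartsOb _ _ _ y (AutSubsheaf (@glued_sheaf _ _ _ _ y z p)).
have glp := @glued_pull _ _ _ _ y z p agree.
pose q i : fhom (z i) x := @PartsHom _ _ _ _ (z i) x (p i) (glp i).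
have Kx : K x := K_local (p := q) cc pp (fun i => proj2_sig (descent_ob D i)).
exists (exist _ x Kx), q; split=> [i|i j V a b e].
  split; [exact: pp|exact: (groupoid_cart full_parts_groupoids)].
apply: parts_hom_eq; rewrite -[RHS](pD i j V a b e) /=.
by rewrite fcompA.
Qed.

Lemma full_parts_stack : stack_in_groupoids full_parts.
Proof.
split; first exact: full_parts_groupoids.
  apply: (glue_sheaf full_parts_groupoids).
    exact: (faithful_separated grH full_forget_faithful (gerbe_separated (H := H))).
  exact/full_glue/parts_glue.
exact: full_parts_effective.
Qed.

End FullParts.

(** * The normalizer *)

Section Connected.
Variables (C : site) (X : fibcat C).

(** When [X] is fibered in groupoids, these are the maps over which [x] and [y] become isomorphic,
    as [conn_fiso] makes precise. *)
Definition conn_sieve (S : C) (x y : X S) : sieve S.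
Proof.
apply: (@Sieve C S (fun V f => exists (z : X V) (p : fhom z x) (q : fhom z y),
  pr p = f /\ pr q = f)) => V W f g [z [p [q [<- pq]]]].
exists (pull g z), (p ⊙ lift g z), (q ⊙ lift g z).
by rewrite !pr_comp lift_pr pq.
Defined.

Lemma locally_connected_conn : locally_connected X ->
  forall S (x y : X S), covers (conn_sieve x y).
Proof.
move=> cX S x y; have [c [cc ci]] := cX S x y.
apply: (covers_sub cc) => V f [i [h ->]]; have [a] := ci i.
apply: sieve_comp.
exists (pull (farr c i) x), (lift _ x), (lift _ y ⊙ iarr a).
by rewrite pr_comp !lift_pr iarr_pr compc1.
Qed.

Hypothesis grX : fibered_in_groupoids X.

Lemma conn_fiso (S U : C) (x y : X S) (f : hom U S) (x' y' : X U)
  (u : fhom x' x) (v : fhom y' y) : pr u = f -> pr v = f ->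
  conn_sieve x y U f -> inhabited (fiso x' y').
Proof.
move=> pu pv [z [p [q [pp pq]]]].
have [|a _] := @factor_fiso _ _ grX _ _ _ _ _ p u; first by rewrite pp.
have [|b _] := @factor_fiso _ _ grX _ _ _ _ _ v q; first by rewrite pv.
exact: (inhabits (fiso_comp b a)).
Qed.

Lemma conn_locally_connected :
  (forall S (x y : X S), covers (conn_sieve x y)) -> locally_connected X.
Proof.
move=> cX S x y; exists (sieve_family (conn_sieve x y)).
split=> [|i]; first exact: sieve_family_cover.
apply: (conn_fiso (lift_pr _ _) (lift_pr _ _)).
exact: (proj2_sig (projT2 i)).
Qed.

End Connected.

Section Atlas.
Variables (C : site) (X Y : fibcat C) (F : fibmor X Y).
Hypothesis grY : fibered_in_groupoids Y.

(** For [Y] fibered in groupoids, this is a cover when [y] is locally in the essential image of [F].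
    The arrows are kept in the index so that they can serve as the pieces in gluing arguments. *)
Definition atlas (S : C) (y : Y S) : family S :=
  @Family C S {V : C & {x : X V & fhom (mob F x) y}} (@projT1 _ _)
    (fun i => pr (projT2 (projT2 i))).

Lemma atlas_mem (S V : C) (y : Y S) (f : hom V S) :
  gen_sieve (atlas y) V f <-> exists (x : X V) (u : fhom (mob F x) y), pr u = f.
Proof.
split=> [[[W [x u]] [h fE]]|[x [u <-]]]; last first.
  by exists (existT _ V (existT _ x u)), (idc V); rewrite compc1.
exists (pull h x), (u ⊙ mhom F (lift h x)).
by rewrite pr_comp mhom_pr lift_pr fE.
Qed.

Lemma atlas_pull (S T : C) (x : Y S) (y : Y T) (u : fhom x y) :
  is_cover (atlas y) -> is_cover (atlas x).
Proof.
move=> cy; apply: (covers_sub (covers_pull (pr u) cy)) => V f.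
case/atlas_mem => z [v pv]; apply/atlas_mem; exists z.
by have [w [pw _]] := factor grY pv; exists w.
Qed.

Lemma atlas_local (S : C) (y : Y S) (c : family S)
  (z : forall i, Y (fdom c i)) (p : forall i, fhom (z i) y) :
  is_cover c -> (forall i, pr (p i) = farr c i) ->
  (forall i, is_cover (atlas (z i))) -> is_cover (atlas y).
Proof.
move=> cc pp cz; apply: (covers_local cc) => i.
apply: (covers_sub (cz i)) => V f /atlas_mem [x [u <-]].
apply/atlas_mem; exists x, (p i ⊙ u); by rewrite pr_comp pp.
Qed.

(** Objects [x] of [X] exist over a cover, and the image of each is locally isomorphic to the
    restriction [y'] of [y]. *)
Lemma atlas_conn (S : C) (y : Y S) : locally_nonempty X ->
  (forall V (f : hom V S), exists (y' : Y V) (u : fhom y' y), pr u = f /\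
     forall x : X V, covers (conn_sieve (mob F x) y')) ->
  is_cover (atlas y).
Proof.
move=> neX cy; have [c [cc ci]] := neX S.
apply: (covers_local cc) => i; have [x] := ci i.
have [y' [u [pu cxy]]] := cy _ (farr c i).
apply: (covers_sub (cxy x)) => V f cf; apply/atlas_mem; exists (pull f x).
have [||a] := conn_fiso grY (u := mhom F (lift f x)) (v := lift f y') _ _ cf.
- by rewrite mhom_pr lift_pr.
- by rewrite lift_pr.
by exists (u ⊙ lift f y' ⊙ iarr a); rewrite !pr_comp lift_pr iarr_pr compc1 pu.
Qed.

Lemma atlas_connected (S : C) (y y' : Y S) :
  (forall V (x x' : X V), covers (conn_sieve (mob F x) (mob F x'))) ->
  is_cover (atlas y) -> is_cover (atlas y') -> covers (conn_sieve y y').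
Proof.
move=> cF cy cy'; apply: (covers_local cy) => - [V [x u]] /=.
apply: (covers_trans (covers_pull (pr u) cy')) => W f /atlas_mem [x' [v pv]].
apply: (covers_sub (cF _ (pull f x) x')) => Q h [z [p [q [pp pq]]]].
exists z, (u ⊙ mhom F (lift f x) ⊙ p), (v ⊙ q).
by rewrite !pr_comp mhom_pr lift_pr pp pq pv !compcA.
Qed.

End Atlas.

Section Pretypes.
Variables (C : site) (H : gerbe C).
Let grH := @gerbe_groupoids C H.
Let grP := @parts_groupoids C H.

(** The right-hand side is the condition for [a] to be an arrow of [parts H]. Hence the pre-type
    condition says that any two values over the same object of [C] are locally isomorphic in
    [parts H]. *)
Lemma conj_pull_subset (S : C) (x y : H S) (a : fiso x y)
  (P : isom_subset x x) (Q : isom_subset y y) :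
  eq_subset (conj_subset a P) Q <-> eq_subset P (pull_subset (iarr a) Q).
Proof.
have pullK (z z' : H S) (b : fiso z z') (R : isom_subset z z) :
    eq_subset (pull_subset (iarr b) (pull_subset (iinv b) R)) R.
  apply: eq_subset_trans (pull_subset_comp grH _ _ _) _.
  rewrite iarrK; exact/eq_subset_sym/pull_subset_id.
split=> PQ.
  apply: eq_subset_trans (eq_subset_sym (pullK _ _ a P)) _.
  apply: eq_pull_subset; apply: eq_subset_trans PQ.
  exact/eq_subset_sym/conj_subsetE.
apply: eq_subset_trans (conj_subsetE a P) _.
apply: eq_subset_trans (eq_pull_subset _ PQ) _; exact: (pullK _ _ (fiso_inv a)).
Qed.

Variables (X : fibcat C) (phi : fibmor X (parts H)).

Lemma pretype_conn : is_pretype phi ->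
  forall S (x y : X S), covers (conn_sieve (mob phi x) (mob phi y)).
Proof.
move=> [_ pre] S x y; have [c [cc ci]] := pre S x y.
apply: (covers_sub cc) => V f [i [h ->]]; have [a /conj_pull_subset aE] := ci i.
pose b : fhom (mob phi (pull (farr c i) x)) (mob phi (pull (farr c i) y)) :=
  PartsHom aE.
apply: sieve_comp.
exists (mob phi (pull (farr c i) x)), (mhom phi (lift _ x)),
  (mhom phi (lift _ y) ⊙ b).
have pb : pr b = idc _ := iarr_pr a.
by rewrite pr_comp pb !mhom_pr !lift_pr compc1.
Qed.

Lemma conn_pretype : locally_nonempty X ->
  (forall S (x y : X S), covers (conn_sieve (mob phi x) (mob phi y))) ->
  is_pretype phi.
Proof.
move=> neX cX; split=> // S x y.
exists (sieve_family (conn_sieve (mob phi x) (mob phi y))).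
split=> [|i]; first exact: sieve_family_cover.
have [||a] := conn_fiso grP
  (u := mhom phi (lift (farr (sieve_family _) i) x))
  (v := mhom phi (lift (farr (sieve_family _) i) y)) _ _
  (proj2_sig (projT2 i)).
- by rewrite mhom_pr lift_pr.
- by rewrite mhom_pr lift_pr.
exists (mob_fiso (parts_forget H) a); apply/conj_pull_subset.
exact: (parts_arrP (iarr a)).
Qed.

End Pretypes.

Lemma pretype_equiv_refl (C : site) (H : gerbe C) (phi : pretype H) :
  pretype_equiv phi phi.
Proof.
apply: conn_pretype.
  move=> S; have [c [cc ci]] := proj1 (pre_ok phi) S.
  exists c; split=> // i; have [x] := ci i; exact: (inhabits (inl x)).
by move=> S [x|x] [y|y]; apply: (pretype_conn (pre_ok phi)).
Qed.

Section NormalizerGerbe.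
Variables (C : site) (H : gerbe C) (phi : pretype H).
Let grP := @parts_groupoids C H.

Definition norm_ob (S : C) (x : parts H S) : Prop := is_cover (atlas phi x).

Lemma norm_pull S T (x : parts H S) (y : parts H T) :
  fhom x y -> norm_ob y -> norm_ob x.
Proof. exact: atlas_pull. Qed.

Definition norm_fib : fibcat C := full_parts norm_pull.

Lemma norm_fib_stack : stack_in_groupoids norm_fib.
Proof. apply: full_parts_stack; exact: atlas_local. Qed.

Lemma norm_ob_phi S (s : pre_sample phi S) : norm_ob (mob phi s).
Proof.
apply: (covers_sub (covers_max S)) => V f _; apply/atlas_mem.
by exists (pull f s), (mhom phi (lift f s)); rewrite mhom_pr lift_pr.
Qed.

Lemma norm_fib_nonempty : locally_nonempty norm_fib.
Proof.
move=> S; have [c [cc ci]] := proj1 (pre_ok phi) S.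
exists c; split=> // i; have [x] := ci i.
exact: (inhabits (exist _ _ (norm_ob_phi x))).
Qed.

Lemma norm_fib_connected : locally_connected norm_fib.
Proof.
apply: conn_locally_connected; first by case: norm_fib_stack.
move=> S x y.
apply: (covers_sub (atlas_connected (pretype_conn (pre_ok phi))
  (proj2_sig x) (proj2_sig y))) => V f [z [p [q pq]]].
by exists (exist _ z (norm_pull p (proj2_sig x))), p, q.
Qed.

Definition norm_gerbe : gerbe C :=
  Gerbe norm_fib_stack norm_fib_nonempty norm_fib_connected.

Definition norm_mor : fibmor norm_gerbe H := full_forget norm_pull.

Lemma norm_ob_of_type (X : fibcat C) (psi : fibmor X (parts H)) :
  is_pretype (copair psi phi) -> forall S (x : X S), norm_ob (mob psi x).
Proof.
move=> pre S x; apply: (atlas_conn grP (proj1 (pre_ok phi))) => V f.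
exists (mob psi (pull f x)), (mhom psi (lift f x)).
rewrite mhom_pr lift_pr; split=> // s.
exact: (@pretype_conn _ _ _ _ pre V (inr s) (inl (pull f x))).
Qed.

End NormalizerGerbe.

(** * Normalizing factorizations *)

Section Normalizing.
Variables (C : site) (H N : gerbe C) (nu : fibmor N H).
Variables (X : fibcat C) (psi : fibmor X (parts H)) (mu : fibmor X N).
Variable theta : fibiso (fibmor_comp nu mu) (underlying psi).
Let grH := @gerbe_groupoids C H.
Let grN := @gerbe_groupoids C N.
Local Notation f := (underlying psi).

(** The condition for [w] to underlie an arrow of [parts H] from [mob psi x] to [mob psi y]. *)
Definition carries S T (x : X S) (y : X T) (w : fhom (mob f x) (mob f y)) :=
  eq_subset (part_of psi x) (pull_subset w (part_of psi y)).

Lemma theta_nat S T (x : X S) (y : X T) (u : fhom x y) :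
  iarr (niso theta y) ⊙ mhom nu (mhom mu u) = mhom f u ⊙ iarr (niso theta x).
Proof. exact: (niso_nat theta u). Qed.

Lemma comparisonE S U (g : hom U S) (x : X S) :
  lift g (mob f x) ⊙ iarr (comparison theta g x) =
  iarr (niso theta x) ⊙ mhom nu (lift g (mob mu x)).
Proof. exact: base_changeE. Qed.

Lemma isom_mapE S U (g : hom U S) (x y : X S)
  (b : Isom (mob mu x) (mob mu y) g) (a : Isom (mob f x) (mob f y) g) :
  isom_map theta b = a <->
  iarr (comparison theta g y) ⊙ mhom nu (iarr b) =
  iarr a ⊙ iarr (comparison theta g x).
Proof.
rewrite /isom_map.
move: (comparison theta g x) (comparison theta g y) => cx cy.
split=> [<-|ab]; first by rewrite /= -!fcompA iarrK fcomp1.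
by apply: fiso_eq; rewrite /= fcompA ab -fcompA iinvK fcomp1.
Qed.

Lemma isom_of_partsE S U (g : hom U S) (x y : X S)
  (a : Isom (mob f x) (mob f y) g) :
  isom_of_parts (psi := psi) a <->
  eq_subset (pull_subset (lift g (mob f x)) (part_of psi x))
            (pull_subset (lift g (mob f y) ⊙ iarr a) (part_of psi y)).
Proof.
have E : eq_subset (conj_subset (fiso_inv a) (restrict g (part_of psi y)))
    (pull_subset (lift g (mob f y) ⊙ iarr a) (part_of psi y)).
  apply: eq_subset_trans (conj_subsetE _ _) _.
  exact: (pull_subset_comp grH).
split=> aE.
  by apply: eq_subset_trans (eq_subset_sym aE) _.
by apply: eq_subset_trans E _; apply: eq_subset_sym.
Qed.

Lemma mhom_carries S T (x : X S) (y : X T) (u : fhom x y) :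
  eq_subset (part_of psi x) (pull_subset (mhom f u) (part_of psi y)).
Proof. exact: (parts_arrP (mhom psi u)). Qed.

Lemma carries_factor S T R (x : X S) (y : X T) (z : X R)
  (v : fhom y z) (w : fhom (mob f x) (mob f y)) :
  carries (mhom f v ⊙ w) <-> carries w.
Proof.
have E : eq_subset (pull_subset w (part_of psi y))
    (pull_subset (mhom f v ⊙ w) (part_of psi z)).
  apply: eq_subset_trans (pull_subset_comp grH _ _ _).
  exact/eq_pull_subset/mhom_carries.
by split=> cw; apply: (eq_subset_trans cw) => //; apply: eq_subset_sym.
Qed.

Section Transfer.
Variables (S U : C) (g : hom U S) (x y : X S) (x' y' : X U).
Variables (xi : fhom x' x) (eta : fhom y' y).
Hypotheses (xi_pr : pr xi = g) (eta_pr : pr eta = g).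
Variables (a : Isom (mob f x) (mob f y) g) (w : fhom (mob f x') (mob f y')).
Hypothesis w_pr : pr w = idc U.
Variable i : fiso (mob f x') (pull g (mob f x)).
Hypothesis iE : lift g (mob f x) ⊙ iarr i = mhom f xi.
Hypothesis awE : lift g (mob f y) ⊙ iarr a ⊙ iarr i = mhom f eta ⊙ w.

(** Here [x'] and [y'] restrict [x] and [y] along [g], and [w] is the section [a] read between their
    images. This lemma and the next translate [normalizing_factorization], stated on chosen
    pullbacks in [H], into a condition on arrows between values of [f]. *)
Lemma isom_of_parts_transfer : isom_of_parts (psi := psi) a <-> carries w.
Proof.
apply: iff_trans (isom_of_partsE a) _.
have xE : eq_subset (part_of psi x') (pull_subset (iarr i)
    (pull_subset (lift g (mob f x)) (part_of psi x))).
  apply: eq_subset_trans (mhom_carries xi) _; rewrite -iE.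
  exact/eq_subset_sym/(pull_subset_comp grH).
have yE : eq_subset (pull_subset w (part_of psi y')) (pull_subset (iarr i)
    (pull_subset (lift g (mob f y) ⊙ iarr a) (part_of psi y))).
  apply: eq_subset_trans (eq_pull_subset _ (mhom_carries eta)) _.
  apply: eq_subset_trans (pull_subset_comp grH _ _ _) _; rewrite -awE.
  exact/eq_subset_sym/(pull_subset_comp grH).
split=> aw.
  apply: eq_subset_trans xE _; apply: eq_subset_trans (eq_subset_sym yE).
  exact: eq_pull_subset.
apply: (pull_subset_iso_inj grH (iinvK i)).
by apply: eq_subset_trans (eq_subset_sym xE) _; apply: eq_subset_trans aw _.
Qed.

Lemma isom_map_transfer : (exists b, isom_map theta b = a) <->
  exists v : fhom (mob mu x') (mob mu y'),
    iarr (niso theta y') ⊙ mhom nu v = w ⊙ iarr (niso theta x').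
Proof.
have [|jx jxE] := @factor_fiso _ _ grN _ _ _ _ _ (lift g (mob mu x)) (mhom mu xi).
  by rewrite mhom_pr lift_pr.
have [|jy jyE] := @factor_fiso _ _ grN _ _ _ _ _ (lift g (mob mu y)) (mhom mu eta).
  by rewrite mhom_pr lift_pr.
have [|iy iyE] := @factor_fiso _ _ grH _ _ _ _ _ (lift g (mob f y)) (mhom f eta).
  by rewrite mhom_pr lift_pr.
have cx : iarr (comparison theta g x) ⊙ mhom nu (iarr jx) =
    iarr i ⊙ iarr (niso theta x').
  apply: (arrow_inj grH (u := lift g (mob f x))).
    by rewrite !pr_comp mhom_pr !iarr_pr.
  by rewrite !fcompA comparisonE iE -fcompA -mhom_comp jxE theta_nat.
have cy : iarr (comparison theta g y) ⊙ mhom nu (iarr jy) =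
    iarr iy ⊙ iarr (niso theta y').
  apply: (arrow_inj grH (u := lift g (mob f y))).
    by rewrite !pr_comp mhom_pr !iarr_pr.
  by rewrite !fcompA comparisonE iyE -fcompA -mhom_comp jyE theta_nat.
have iyw : iarr iy ⊙ w = iarr a ⊙ iarr i.
  apply: (arrow_inj grH (u := lift g (mob f y))).
    by rewrite !pr_comp !iarr_pr w_pr.
  by rewrite !fcompA iyE awE.
have ax : iarr a ⊙ iarr (comparison theta g x) ⊙ mhom nu (iarr jx) =
    iarr iy ⊙ w ⊙ iarr (niso theta x').
  by rewrite -fcompA cx iyw fcompA.
split=> [[b /isom_mapE bE]|[v vE]].
  exists (iinv jy ⊙ iarr b ⊙ iarr jx).
  rewrite -[LHS]fcomp1f -(iarrK iy) -!fcompA (fcompA (iarr iy) (iarr _)) -cy.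
  rewrite !mhom_comp !fcompA -(fcompA _ (mhom nu (iarr jy))) -mhom_comp iinvK.
  rewrite mhom_id fcomp1 -(fcompA (iinv iy)) bE -fcompA ax !fcompA iarrK.
  by rewrite fcomp1f.
have pv : pr v = idc U.
  move/(congr1 pr): vE.
  by rewrite !pr_comp mhom_pr w_pr !iarr_pr comp1c compc1.
have [b bE] := groupoid_fiso grN pv.
exists (fiso_comp jy (fiso_comp b (fiso_inv jx))); apply/isom_mapE.
have -> : iarr (fiso_comp jy (fiso_comp b (fiso_inv jx))) =
  iarr jy ⊙ (iarr b ⊙ iinv jx) by [].
rewrite !mhom_comp fcompA cy bE fcompA -(fcompA (iarr iy)) vE !fcompA -ax.
by rewrite -fcompA -mhom_comp iinvK mhom_id fcomp1.
Qed.

End Transfer.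

(** Factoring through the image of a lift of [y] replaces [w] by a vertical arrow [w'], to which the
    transfer applies over [idc S] with identities for [xi] and [eta]. *)
Lemma normalizing_arrow : normalizing_factorization theta ->
  forall S T (x : X S) (y : X T) (w : fhom (mob f x) (mob f y)),
  (exists v : fhom (mob mu x) (mob mu y),
    iarr (niso theta y) ⊙ mhom nu v = w ⊙ iarr (niso theta x)) <-> carries w.
Proof.
move=> norm S T x y w.
have [|w' [pw' w'E]] := @factor _ _ grH _ _ _ _ _ _ (mhom f (lift (pr w) y)) w (idc S).
  by rewrite mhom_pr lift_pr compc1.
rewrite -w'E; apply: iff_trans (iff_sym (carries_factor _ _)).
have [|i iE] := @factor_fiso _ _ grH _ _ _ _ _ (lift (idc S) (mob f x)) (mhom f (fid x)).
  by rewrite mhom_pr pr_id lift_pr.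
have [|a aE] := @factor_fiso _ _ grH _ _ _ _ _ (lift (idc S) (mob f (pull (pr w) y)))
    (w' ⊙ iinv i).
  by rewrite pr_comp iinv_pr pw' lift_pr compc1.
have awE : lift (idc S) _ ⊙ iarr a ⊙ iarr i = mhom f (fid (pull (pr w) y)) ⊙ w'.
  by rewrite aE -fcompA iarrK fcomp1 mhom_id fcomp1f.
apply: iff_trans (isom_of_parts_transfer iE awE).
apply: iff_trans (proj2 (norm _ _ _ _ _) a).
apply: iff_trans (iff_sym (isom_map_transfer (pr_id _) (pr_id _) pw' iE awE)).
split=> [[v vE]|[v vE]].
  have [|v' [pv' v'E]] := @factor _ _ grN _ _ _ _ _ _
      (mhom mu (lift (pr w) y)) v (idc S).
    move/(congr1 pr): vE.
    by rewrite w'E !pr_comp !mhom_pr !iarr_pr lift_pr comp1c !compc1.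
  exists v'; apply: (arrow_inj grH (u := mhom f (lift (pr w) y))).
    by rewrite !pr_comp mhom_pr pv' pw' !iarr_pr.
  by rewrite !fcompA -vE -theta_nat -v'E mhom_comp fcompA.
exists (mhom mu (lift (pr w) y) ⊙ v).
by rewrite mhom_comp fcompA theta_nat -!fcompA vE.
Qed.

Lemma normalizing_of_arrow : faithful nu ->
  (forall S (x y : X S) (w : fhom (mob f x) (mob f y)),
    (exists v : fhom (mob mu x) (mob mu y),
      iarr (niso theta y) ⊙ mhom nu v = w ⊙ iarr (niso theta x)) <-> carries w) ->
  normalizing_factorization theta.
Proof.
move=> faith arr S x y U g; split=> [b b' /isom_mapE bb'|a].
  apply/fiso_eq/faith; apply: (arrow_inj grH (u := iarr (comparison theta g y))).
    by rewrite !mhom_pr !iarr_pr.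
  by rewrite bb'; apply/esym/isom_mapE.
have [|i iE] := @factor_fiso _ _ grH _ _ _ _ _ (lift g (mob f x)) (mhom f (lift g x)).
  by rewrite mhom_pr !lift_pr.
have [|w [pw wE]] := @factor _ _ grH _ _ _ _ _ _ (mhom f (lift g y))
    (lift g (mob f y) ⊙ iarr a ⊙ iarr i) (idc U).
  by rewrite !pr_comp !iarr_pr mhom_pr !lift_pr !compc1.
apply: iff_trans (isom_map_transfer (lift_pr g x) (lift_pr g y) pw iE (esym wE)) _.
apply: iff_trans (arr _ _ _ _) _.
exact: (iff_sym (isom_of_parts_transfer iE (esym wE))).
Qed.

(** One condition conjugates by the inverse of [a], the other by [a]; they agree because the same
    subsheaf stands on both sides. *)
Lemma normalizer_isom_of_parts S (x : X S) U (g : hom U S)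
  (a : Isom (mob f x) (mob f x) g) :
  isom_of_parts (psi := psi) a <-> normalizer_subset (part_of psi x) a.
Proof.
have inv (b : Isom (mob f x) (mob f x) g) (P Q : isom_subset (pull g (mob f x)) _) :
    eq_subset (conj_subset (fiso_inv b) P) Q <-> eq_subset (conj_subset b Q) P.
  apply: iff_trans (conj_pull_subset (fiso_inv b) P Q) _ => /=.
  split=> PQ.
    apply: eq_subset_trans (conj_subsetE _ _) _; exact: eq_subset_sym.
  apply: eq_subset_trans (eq_subset_sym PQ) _; exact: conj_subsetE.
exact: inv.
Qed.

End Normalizing.

(** Objects of the normalizer already carry a subsheaf, so [psi] itself lands in it and [theta]
    consists of identities; its arrows are by construction the arrows of [H] that respect the
    subsheaves. *)
Lemma norm_factorization (C : site) (H : gerbe C) (phi : pretype H)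
  (X : fibcat C) (psi : fibmor X (parts H)) :
  is_pretype (copair psi phi) ->
  exists (mu : fibmor X (norm_gerbe phi))
    (theta : fibiso (fibmor_comp (norm_mor phi) mu) (underlying psi)),
  normalizing_factorization theta.
Proof.
move=> pre; pose mu : fibmor X (norm_gerbe phi) :=
  @full_lift_mor _ (parts H) (@parts_cart C H) _ (@norm_pull C H phi) X psi
    (norm_ob_of_type pre).
have nat S T (x : X S) (y : X T) (u : fhom x y) :
    iarr (fiso_id (mob (underlying psi) y)) ⊙ mhom (fibmor_comp (norm_mor phi) mu) u =
    mhom (underlying psi) u ⊙ iarr (fiso_id (mob (underlying psi) x)).
  by rewrite /= fcomp1 fcomp1f.
exists mu, (@FibIso _ _ _ (fibmor_comp (norm_mor phi) mu) (underlying psi)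
  (fun S x => fiso_id _) nat).
apply: normalizing_of_arrow; first exact: full_forget_faithful.
move=> S x y w; rewrite /= fcomp1; split=> [[v]|cw].
  rewrite fcomp1f => <-; exact: (parts_arrP v).
by exists (PartsHom cw); rewrite fcomp1f.
Qed.

(** * Comparison of normalizers *)

Section Arises.
Variables (C : site) (H N : gerbe C) (nu : fibmor N H).
Variables (X : fibcat C) (psi : fibmor X (parts H)) (mu : fibmor X N).
Variable theta : fibiso (fibmor_comp nu mu) (underlying psi).
Let grH := @gerbe_groupoids C H.
Let grN := @gerbe_groupoids C N.
Local Notation f := (underlying psi).

Definition arises S V (n : N S) (s : X V) (w : fhom (mob f s) (mob nu n)) :=
  exists u : fhom (mob mu s) n, mhom nu u = w ⊙ iarr (niso theta s).

Hypothesis faith : faithful nu.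
Hypothesis norm : normalizing_factorization theta.

Lemma arises_comp S V W (n : N S) (s : X W) (t : X V)
  (w : fhom (mob f t) (mob nu n)) (w0 : fhom (mob f s) (mob f t)) :
  arises w -> carries w0 -> arises (w ⊙ w0).
Proof.
move=> [u uE] /(normalizing_arrow norm) [v vE]; exists (u ⊙ v).
by rewrite mhom_comp uE -!fcompA vE.
Qed.

(** With [arises_comp]: beside an arising [w], the composite [w ⊙ w0] arises exactly when [w0]
    carries, a condition that does not mention [N]. *)
Lemma arises_carries S V W (n : N S) (s : X W) (t : X V)
  (w : fhom (mob f t) (mob nu n)) (w0 : fhom (mob f s) (mob f t)) :
  arises w -> arises (w ⊙ w0) -> carries w0.
Proof.
move=> [u uE] [u' u'E].
have pu : pr u = pr w.
  by move/(congr1 pr): uE; rewrite pr_comp mhom_pr iarr_pr compc1.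
have pu' : pr u' = pr w ∘ pr w0.
  by move/(congr1 pr): u'E; rewrite !pr_comp mhom_pr iarr_pr compc1.
have [|v [pv vE]] := @factor _ _ grN _ _ _ _ _ _ u u' (pr w0).
  by rewrite pu.
apply/(normalizing_arrow norm); exists v.
apply: (arrow_inj grH (u := w)).
  by rewrite !pr_comp mhom_pr !iarr_pr pv comp1c compc1.
by rewrite !fcompA -uE -mhom_comp vE u'E.
Qed.

Lemma arises_mhom S T V (n : N S) (m : N T) (v : fhom n m) (s : X V)
  (w : fhom (mob f s) (mob nu n)) : arises w -> arises (mhom nu v ⊙ w).
Proof.
by case=> u uE; exists (v ⊙ u); rewrite mhom_comp uE fcompA.
Qed.

Lemma arises_mu S V (s : X S) (t : X V) (w : fhom (mob f t) (mob f s)) :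
  carries w <-> arises (n := mob mu s) (iinv (niso theta s) ⊙ w).
Proof.
split=> [/(normalizing_arrow norm) [v vE]|[v vE]].
  by exists v; rewrite -fcompA -vE fcompA iarrK fcomp1f.
apply/(normalizing_arrow norm); exists v.
by rewrite vE !fcompA iinvK fcomp1f.
Qed.

Lemma arises_arrow S V (n : N S) (s : X V) (u : fhom (mob mu s) n) :
  arises (mhom nu u ⊙ iinv (niso theta s)).
Proof. by exists u; rewrite -fcompA iarrK fcomp1. Qed.

(** Lifts along the faithful [nu] are unique, so local lifts agree on overlaps and glue in [N]. *)
Lemma arises_local S V (n : N S) (s : X V) (w : fhom (mob f s) (mob nu n))
  (R : sieve V) : covers R ->
  (forall W (t : X W) (g : fhom t s), R W (pr g) -> arises (w ⊙ mhom f g)) ->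
  arises w.
Proof.
move=> cR locw.
pose c := @Family C V {W : C & {t : X W & {g : fhom t s | R W (pr g)}}}
  (@projT1 _ _) (fun i => pr (proj1_sig (projT2 (projT2 i)))).
have cc : is_cover c.
  apply: (covers_sub cR) => W h Rh.
  have Rl : R W (pr (lift h s)) by rewrite lift_pr.
  exists (existT _ W (existT _ (pull h s) (exist _ (lift h s) Rl))), (idc W).
  by rewrite /= lift_pr compc1.
pose g (i : fidx c) := proj1_sig (projT2 (projT2 i)).
have q_sig (i : fidx c) : {u : fhom (mob mu (projT1 (projT2 i))) n |
    mhom nu u = w ⊙ mhom f (g i) ⊙ iarr (niso theta _)}.
  apply: constructive_indefinite_description.
  exact: (locw _ _ _ (proj2_sig (projT2 (projT2 i)))).
pose q i := proj1_sig (q_sig i).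
have qE i : mhom nu (q i) = w ⊙ iarr (niso theta s) ⊙ mhom nu (mhom mu (g i)).
  by rewrite (proj2_sig (q_sig i)) -!fcompA theta_nat.
have [|i|i j W t a b ab|u [pu uE]] := gerbe_glue (H := N) (k := pr w)
  (p := fun i => mhom mu (g i)) (q := q) cc.
- by move=> i; rewrite mhom_pr.
- move/(congr1 pr): (qE i).
  by rewrite !pr_comp !mhom_pr iarr_pr compc1.
- by apply: faith; rewrite !mhom_comp !qE -!fcompA -!mhom_comp ab.
exists u; apply: (gerbe_separated cR).
  by rewrite mhom_pr pr_comp iarr_pr compc1.
move=> W z p Rp.
have [|d <-] := @factor_fiso _ _ grH _ _ _ _ _ (mhom nu (mhom mu (lift (pr p) s))) p.
  by rewrite !mhom_pr lift_pr.
have Rl : R W (pr (lift (pr p) s)) by rewrite lift_pr.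
pose i : fidx c := existT _ W (existT _ _ (exist _ (lift (pr p) s) Rl)).
by rewrite !fcompA -mhom_comp (uE i); congr (_ ⊙ _); apply: (qE i).
Qed.

Hypothesis neX : locally_nonempty X.

(** Local connectedness of the gerbe [N] enters here. *)
Lemma mu_atlas S (n : N S) : is_cover (atlas mu n).
Proof.
apply: (atlas_conn grN neX) => V g; exists (pull g n), (lift g n).
rewrite lift_pr; split=> // x.
exact/locally_connected_conn/gerbe_connected.
Qed.

(** Each arrow [p i] of the atlas of [n] gives an arising arrow, whose composite with [w] lifts to
    [N]; by faithfulness these lifts glue. *)
Lemma arises_full S T (n : N S) (m : N T) (w : fhom (mob nu n) (mob nu m)) :
  (forall V (s : X V) (a : fhom (mob f s) (mob nu n)), arises a ->
    arises (w ⊙ a)) -> exists v : fhom n m, mhom nu v = w.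
Proof.
move=> wA; pose c := atlas mu n; have cc : is_cover c := mu_atlas n.
pose p (i : fidx c) : fhom (mob mu (projT1 (projT2 i))) n := projT2 (projT2 i).
have q_sig i : {u : fhom (mob mu (projT1 (projT2 i))) m |
    mhom nu u = w ⊙ mhom nu (p i)}.
  apply: constructive_indefinite_description.
  have [u uE] := wA _ _ _ (arises_arrow (p i)).
  by exists u; rewrite uE -!fcompA iarrK fcomp1.
pose q i := proj1_sig (q_sig i).
have qE i : mhom nu (q i) = w ⊙ mhom nu (p i) := proj2_sig (q_sig i).
have [|i|i j V t a b ab|v [pv vE]] := gerbe_glue (H := N) (k := pr w)
  (p := p) (q := q) cc.
- by [].
- by move/(congr1 pr): (qE i); rewrite pr_comp !mhom_pr.
- by apply: faith; rewrite !mhom_comp !qE -!fcompA -!mhom_comp ab.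
exists v; apply: (gerbe_separated cc); first by rewrite mhom_pr.
move=> V z r [i [h rE]].
have [|d [_ <-]] := @factor _ _ grH _ _ _ _ _ _ (mhom nu (p i)) r h.
  by rewrite rE mhom_pr.
by rewrite !fcompA -mhom_comp vE qE.
Qed.

(** An object of [N] is built over [h] with prescribed arising arrows. The hypothesis on overlaps
    lifts them to [N] by [normalizing_arrow], as [faithful_descent] requires. *)
Lemma arises_descent S (h : H S) (c : family S)
  (s : forall i, X (fdom c i)) (p : forall i, fhom (mob f (s i)) h) :
  is_cover c -> (forall i, pr (p i) = farr c i) ->
  (forall i j V (t : X V) (d : fhom t (s i)) (w : fhom (mob f t) (mob f (s j))),
    p i ⊙ mhom f d = p j ⊙ w -> carries w) ->
  exists (n : N S) (b : fiso (mob nu n) h), forall i,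
    exists2 w : fhom (mob f (s i)) (mob nu n), arises w & iarr b ⊙ w = p i.
Proof.
move=> cc pp pA.
have [||n [b [q qE]]] := @faithful_descent C N H nu (gerbe_stack N) (gerbe_stack H)
  faith S c h (fun i => mob mu (s i)) (fun i => p i ⊙ iarr (niso theta (s i))) cc.
- by move=> i; rewrite pr_comp iarr_pr compc1.
- move=> i j V a g ag.
  have [|w [pw wE]] := @factor _ _ grH _ _ _ _ _ _ (p j)
      (p i ⊙ mhom f (lift a (s i))) g.
    by rewrite pr_comp mhom_pr lift_pr !pp.
  have /(normalizing_arrow norm) [v vE] := pA _ _ _ _ _ _ (esym wE).
  exists (mob mu (pull a (s i))), (mhom mu (lift a (s i))), v; split.
  + by rewrite mhom_pr lift_pr.
  + by move/(congr1 pr): vE; rewrite !pr_comp mhom_pr !iarr_pr comp1c compc1 pw.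
  + by rewrite -!fcompA theta_nat vE !fcompA wE.
exists n, b => i; exists (mhom nu (q i) ⊙ iinv (niso theta (s i))).
  exact: arises_arrow.
by rewrite fcompA qE -fcompA iinvK fcomp1.
Qed.

Lemma arises_fibiso (Y : fibcat C) (K L : fibmor Y N)
  (e : fibiso (fibmor_comp nu K) (fibmor_comp nu L)) :
  (forall S (y : Y S) V (s : X V) (w : fhom (mob f s) (mob nu (mob K y))),
    arises w -> arises (n := mob L y) (iarr (niso e y) ⊙ w)) ->
  exists a : fibiso K L, forall S (y : Y S),
    mhom nu (iarr (niso a y)) = iarr (niso e y).
Proof.
move=> eA.
have a_sig S (y : Y S) : {a : fiso (mob K y) (mob L y) |
    mhom nu (iarr a) = iarr (niso e y)}.
  apply: constructive_indefinite_description.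
  have [v vE] := arises_full (eA S y).
  have pv : pr v = idc S.
    by have := congr1 pr vE; rewrite mhom_pr => ->; apply: (iarr_pr (niso e y)).
  by have [a aE] := groupoid_fiso grN pv; exists a; rewrite aE.
have aE S (y : Y S) : mhom nu (iarr (proj1_sig (a_sig S y))) = iarr (niso e y).
  exact: (proj2_sig (a_sig S y)).
have nat S T (x : Y S) (y : Y T) (u : fhom x y) :
    iarr (proj1_sig (a_sig T y)) ⊙ mhom K u =
    mhom L u ⊙ iarr (proj1_sig (a_sig S x)).
  by apply: faith; rewrite !mhom_comp !aE; apply: (niso_nat e u).
by exists (FibIso nat).
Qed.

End Arises.

(** * Matching the objects of two normalizers *)

Section Compare.
Variables (C : site) (H : gerbe C) (X : fibcat C) (psi : fibmor X (parts H)).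
Hypothesis neX : locally_nonempty X.
Variables (N : gerbe C) (nu : fibmor N H) (mu : fibmor X N).
Variable theta : fibiso (fibmor_comp nu mu) (underlying psi).
Hypotheses (faith : faithful nu) (norm : normalizing_factorization theta).
Variables (N' : gerbe C) (nu' : fibmor N' H) (mu' : fibmor X N').
Variable theta' : fibiso (fibmor_comp nu' mu') (underlying psi).
Hypotheses (faith' : faithful nu') (norm' : normalizing_factorization theta').
Let grH := @gerbe_groupoids C H.
Local Notation f := (underlying psi).

Definition matches S (n : N S) (n' : N' S) (b : fiso (mob nu' n') (mob nu n)) :=
  forall V (s : X V) (w : fhom (mob f s) (mob nu' n')),
    arises theta' w <-> arises theta (iarr b ⊙ w).

Lemma match_exists S (n : N S) :
  exists (n' : N' S) (b : fiso (mob nu' n') (mob nu n)), matches b.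
Proof.
pose c := atlas mu n; have cc : is_cover c := mu_atlas mu neX n.
pose s (i : fidx c) := projT1 (projT2 i).
pose u (i : fidx c) : fhom (mob mu (s i)) n := projT2 (projT2 i).
pose p i := mhom nu (u i) ⊙ iinv (niso theta (s i)).
have pA i : arises theta (p i) := arises_arrow theta (u i).
have pp i : pr (p i) = farr c i by rewrite pr_comp mhom_pr iinv_pr compc1.
have [|n' [b bE]] := arises_descent faith' norm' cc pp.
  (* The arrow [p i ⊙ mhom f d] arises for [N] because [mhom f d] carries; written as [p j ⊙ w], it
     forces [w] to carry. *)
  move=> i j V t d w dw.
  apply: (arises_carries norm (pA j)); rewrite -dw.
  apply: (arises_comp norm (pA i)); exact: mhom_carries.
exists n', b => V t w.
(* Locally [w] becomes [w' ⊙ w0], where [w'] arises for [N'] and [iarr b ⊙ w'] arises for [N]. For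
   both normalizers, arising is then equivalent to [carries w0]. *)
have local W (t' : X W) (g : fhom t' t) :
    pull_sieve (pr w) (gen_sieve c) W (pr g) ->
    exists i (w' : fhom (mob f (s i)) (mob nu' n'))
      (w0 : fhom (mob f t') (mob f (s i))),
    [/\ arises theta' w', iarr b ⊙ w' = p i & w ⊙ mhom f g = w' ⊙ w0].
  case=> i [h hE]; have [w' Aw' bw'] := bE i.
  have pw' : pr w' = farr c i.
    by rewrite -pp -bw' pr_comp iarr_pr comp1c.
  have [|w0 [_ w0E]] := @factor _ _ grH _ _ _ _ _ _ w' (w ⊙ mhom f g) h.
    by rewrite pr_comp mhom_pr pw'.
  by exists i, w', w0; split.
split=> Aw.
  apply: (arises_local faith (covers_pull (pr w) cc)) => W t' g Rg.
  have [i [w' [w0 [Aw' bw' wg]]]] := local _ _ _ Rg.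
  rewrite -fcompA wg fcompA bw'; apply: (arises_comp norm (pA i)).
  apply: (arises_carries norm' Aw'); rewrite -wg.
  apply: (arises_comp norm' Aw); exact: mhom_carries.
apply: (arises_local faith' (covers_pull (pr w) cc)) => W t' g Rg.
have [i [w' [w0 [Aw' bw' wg]]]] := local _ _ _ Rg.
rewrite wg; apply: (arises_comp norm' Aw').
apply: (arises_carries norm (pA i)); rewrite -bw' -fcompA -wg fcompA.
apply: (arises_comp norm Aw); exact: mhom_carries.
Qed.

Lemma match_functor : exists (F : fibmor N N')
  (b : fibiso (fibmor_comp nu' F) nu), forall S (n : N S), matches (niso b n).
Proof.
have F_sig S (n : N S) :
    {n' : N' S & {b : fiso (mob nu' n') (mob nu n) | matches b}}.
  have /constructive_indefinite_description [n'] := match_exists n.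
  by move/constructive_indefinite_description => bM; exists n'.
pose F S n : N' S := projT1 (F_sig S n).
pose b S n : fiso (mob nu' (F S n)) (mob nu n) := proj1_sig (projT2 (F_sig S n)).
have bM S n : matches (b S n) := proj2_sig (projT2 (F_sig S n)).
have hom_sig S T (n : N S) (m : N T) (v : fhom n m) : {v' : fhom (F S n) (F T m) |
    iarr (b T m) ⊙ mhom nu' v' = mhom nu v ⊙ iarr (b S n)}.
  apply: constructive_indefinite_description.
  have [|v' v'E] := arises_full (theta := theta') faith' neX
    (w := iinv (b T m) ⊙ mhom nu v ⊙ iarr (b S n)).
    move=> V s a /bM /(arises_mhom v) Aa; apply/bM.
    by rewrite !fcompA iinvK fcomp1f -fcompA.
  by exists v'; rewrite v'E !fcompA iinvK fcomp1f.
pose Fh S T n m v := proj1_sig (hom_sig S T n m v).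
have FhE S T n m v : iarr (b T m) ⊙ mhom nu' (Fh S T n m v) =
  mhom nu v ⊙ iarr (b S n) := proj2_sig (hom_sig S T n m v).
(* Equations between arrows into [F S n] can be checked in [H], since [nu'] is faithful; the functor
   laws follow from [FhE] in this way. *)
have b_inj S R (n : N S) (z : N' R) (v v' : fhom z (F S n)) : pr v = pr v' ->
    iarr (b S n) ⊙ mhom nu' v = iarr (b S n) ⊙ mhom nu' v' -> v = v'.
  move=> vv' E; apply: faith'; apply: (arrow_inj grH _ E).
  by rewrite !mhom_pr.
have Fh_pr S T n m v : pr (Fh S T n m v) = pr v.
  move/(congr1 pr): (FhE S T n m v).
  by rewrite !pr_comp !mhom_pr !iarr_pr comp1c compc1.
have Fh_id S n : Fh S S n n (fid n) = fid (F S n).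
  apply: b_inj; first by rewrite Fh_pr !pr_id.
  by rewrite FhE !mhom_id fcomp1 fcomp1f.
have Fh_comp Q S T (l : N Q) (n : N S) (m : N T) (v : fhom n m) (u : fhom l n) :
    Fh Q T l m (v ⊙ u) = Fh S T n m v ⊙ Fh Q S l n u.
  apply: b_inj; first by rewrite pr_comp !Fh_pr pr_comp.
  by rewrite FhE !mhom_comp fcompA FhE -!fcompA FhE.
pose G : fibmor N N' := FibMor Fh_pr Fh_id Fh_comp
  (fun _ _ _ _ _ _ => groupoid_cart (@gerbe_groupoids C N') _).
by exists G, (@FibIso _ _ _ (fibmor_comp nu' G) nu b FhE).
Qed.

End Compare.

(** The isomorphisms [b'] and [b] compose to one from [nu G F] to [nu] in [H]. Both preserve arising
    arrows, hence so does the composite, and [arises_fibiso] lifts it to [N]. *)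
Lemma match_equivalence (C : site) (H : gerbe C) (X : fibcat C)
  (psi : fibmor X (parts H)) (neX : locally_nonempty X)
  (N : gerbe C) (nu : fibmor N H) (mu : fibmor X N)
  (theta : fibiso (fibmor_comp nu mu) (underlying psi))
  (N' : gerbe C) (nu' : fibmor N' H) (mu' : fibmor X N')
  (theta' : fibiso (fibmor_comp nu' mu') (underlying psi))
  (F : fibmor N N') (b : fibiso (fibmor_comp nu' F) nu)
  (G : fibmor N' N) (b' : fibiso (fibmor_comp nu G) nu') :
  faithful nu -> normalizing_factorization theta ->
  (forall S (n : N S), matches theta theta' (niso b n)) ->
  (forall S (n' : N' S), matches theta' theta (niso b' n')) ->
  inhabited (fibiso (fibmor_comp G F) (fibmor_id N)).
Proof.
move=> faith norm bM bM'.
have nat S T (x : N S) (y : N T) (u : fhom x y) :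
    iarr (fiso_comp (niso b y) (niso b' (mob F y))) ⊙
      mhom (fibmor_comp nu (fibmor_comp G F)) u =
    mhom (fibmor_comp nu (fibmor_id N)) u ⊙
      iarr (fiso_comp (niso b x) (niso b' (mob F x))).
  move: (niso_nat b u) (niso_nat b' (mhom F u)) => /= Eb Eb'.
  by rewrite -fcompA Eb' fcompA Eb -fcompA.
pose e := @FibIso _ _ _ (fibmor_comp nu (fibmor_comp G F))
  (fibmor_comp nu (fibmor_id N)) _ nat.
have [|a _] := arises_fibiso (theta := theta) faith neX (e := e); last exact: (inhabits a).
move=> S n V s w /bM' /bM.
by rewrite /= fcompA.
Qed.

Lemma normalizer_unique (C : site) (H : gerbe C) (X : fibcat C)
  (psi : fibmor X (parts H)) (neX : locally_nonempty X)
  (N : gerbe C) (nu : fibmor N H) (mu : fibmor X N)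
  (theta : fibiso (fibmor_comp nu mu) (underlying psi))
  (N' : gerbe C) (nu' : fibmor N' H) (mu' : fibmor X N')
  (theta' : fibiso (fibmor_comp nu' mu') (underlying psi)) :
  faithful nu -> normalizing_factorization theta ->
  faithful nu' -> normalizing_factorization theta' ->
  exists F : fibmor N N', equivalence F /\
    exists (a : fibiso (fibmor_comp F mu) mu') (b : fibiso (fibmor_comp nu' F) nu),
      forall S (s : X S),
        iarr (niso theta' s) ⊙ mhom nu' (iarr (niso a s)) =
        iarr (niso theta s) ⊙ iarr (niso b (mob mu s)).
Proof.
move=> faith norm faith' norm'.
have [F [b bM]] := match_functor neX faith norm faith' norm'.
have [G [b' bM']] := match_functor neX faith' norm' faith norm.
exists F; split.
  exists G; split; first exact: (match_equivalence neX faith norm bM bM').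
  exact: (match_equivalence neX faith' norm' bM' bM).
(* The compatibility with [theta], [theta'] and [b] required in the conclusion dictates [e0]; what
   remains is to lift it along [nu']. *)
have [e0 e0E] : exists e0 : forall S (s : X S),
    fiso (mob nu' (mob F (mob mu s))) (mob nu' (mob mu' s)),
    forall S (s : X S), iarr (niso theta' s) ⊙ iarr (e0 S s) =
      iarr (niso theta s) ⊙ iarr (niso b (mob mu s)).
  exists (fun S s => fiso_comp (fiso_inv (niso theta' s))
    (fiso_comp (niso theta s) (niso b (mob mu s)))) => S s.
  by rewrite /= fcompA iinvK fcomp1f.
have nat S T (x : X S) (y : X T) (u : fhom x y) :
    iarr (e0 T y) ⊙ mhom (fibmor_comp nu' (fibmor_comp F mu)) u =
    mhom (fibmor_comp nu' mu') u ⊙ iarr (e0 S x).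
  apply: (arrow_inj (@gerbe_groupoids C H) (u := iarr (niso theta' y))).
    by rewrite !pr_comp !mhom_pr !iarr_pr !comp1c !compc1.
  move: (niso_nat b (mhom mu u)) (theta_nat theta u) (theta_nat theta' u).
  move=> /= Eb Et Et'.
  by rewrite !fcompA e0E Et' -[RHS]fcompA e0E -fcompA Eb !fcompA Et.
pose e := @FibIso _ _ _ (fibmor_comp nu' (fibmor_comp F mu))
  (fibmor_comp nu' mu') e0 nat.
have [|a aE] := arises_fibiso (theta := theta') faith' neX (e := e).
  move=> S s V t w /bM Aw.
  (* Up to [theta] and [theta'], arising into [mob mu s] and into [mob mu' s] are both the condition
     [carries], which mediates between the two normalizers. *)
  have cw : carries (iarr (niso theta s) ⊙ (iarr (niso b (mob mu s)) ⊙ w)).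
    by apply/(arises_mu norm); rewrite fcompA iarrK fcomp1f.
  move/(arises_mu norm'): cw.
  by rewrite (fcompA (iarr (niso theta s))) -e0E -fcompA fcompA iarrK fcomp1f.
by exists a, b => S s; rewrite aE -e0E.
Qed.

Theorem theoremA11 (C : site) (H : gerbe C) (Theta : type_for H) :
  exists (N : gerbe C) (nu : fibmor N H),
    [/\ faithful nu,
        forall (X : fibcat C) (psi : fibmor X (parts H)), of_type Theta psi ->
          exists (mu : fibmor X N)
                 (theta : fibiso (fibmor_comp nu mu) (underlying psi)),
            normalizing_factorization theta /\
            (forall S (x : X S) U (g : hom U S)
                (a : Isom (mob (underlying psi) x) (mob (underlying psi) x) g),
              (exists b : Isom (mob mu x) (mob mu x) g,
                 isom_map theta b = a) <->
              normalizer_subset (part_of psi x) a) &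
        forall phi : pretype H, Theta phi ->
        forall (mu : fibmor (pre_sample phi) N)
               (theta : fibiso (fibmor_comp nu mu) (underlying phi)),
          normalizing_factorization theta ->
        forall (N' : gerbe C) (nu' : fibmor N' H), faithful nu' ->
        forall (mu' : fibmor (pre_sample phi) N')
               (theta' : fibiso (fibmor_comp nu' mu') (underlying phi)),
          normalizing_factorization theta' ->
          exists F : fibmor N N', equivalence F /\
            exists (a : fibiso (fibmor_comp F mu) mu')
                   (b : fibiso (fibmor_comp nu' F) nu),
              forall S (s : pre_sample phi S),
                iarr (niso theta' s) ⊙ mhom nu' (iarr (niso a s)) =
                iarr (niso theta s) ⊙ iarr (niso b (mob mu s))].
Proof.
have [phi0 phi0P] := in_typeP Theta.
have in0 : Theta phi0 by apply/phi0P/pretype_equiv_refl.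
(* The construction depends on the representative [phi0], to which functors of type [Theta] are
   compared; uniqueness is obtained from the factorizations of an arbitrary [phi] in [Theta]. *)
exists (norm_gerbe phi0), (norm_mor phi0); split.
- exact: full_forget_faithful.
- move=> X psi psiT; have [pre _] := psiT _ in0.
  have [mu [theta norm]] := norm_factorization pre.
  exists mu, theta; split=> // S x U g a.
  apply: iff_trans (proj2 (norm _ _ _ _ _) a) _.
  exact: normalizer_isom_of_parts.
- move=> phi _ mu theta norm N' nu' faith' mu' theta' norm'.
  apply: (normalizer_unique (proj1 (pre_ok phi)) _ norm faith' norm').
  exact: full_forget_faithful.
Qed.
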